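(* Let $a,b\in\mathbb{C}\setminus\{0\}$, $c>0$, $c>|a|+|b|+1$, $0<\lambda\le1$, and $0\le\beta<1$. Assume that $$\frac{\Gamma(c)\,\Gamma(c-|a|-|b|)}{\Gamma(|b|)\,\Gamma(c-|b|)}\Bigg[\frac{|a|}{c-|a|-|b|-1}\sum_{n=0}^{\infty}\binom{-(|a|+1)}{n}\frac{\Gamma(|b|+4+2n)}{\Gamma(c-|a|+3+2n)}\;{}_2F_1(|a|+1,|b|+4+2n;c-|a|+3+2n;-1)$$ $$+\lambda\sum_{n=0}^{\infty}\binom{-|a|}{n}\frac{\Gamma(|b|+2n)}{\Gamma(c-|a|+2n)}\;{}_2F_1(|a|,|b|+2n;c-|a|+2n;-1)\Bigg]\le \lambda\left(1+\frac{1}{2(1-\beta)}\right).$$ Then the operator $\mathcal{I}(f)(z)=z\;{}_5F_4\left(a,\tfrac{b}{4},\tfrac{b+1}{4},\tfrac{b+2}{4},\tfrac{b+3}{4};\tfrac{c}{4},\tfrac{c+1}{4},\tfrac{c+2}{4},\tfrac{c+3}{4};z\right)*f(z)$ maps $\mathcal{R}(\beta)$ into $\mathcal{C}_\lambda$.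
   Context: $\mathbb{D}=\{z\in\mathbb{C}:|z|<1\}$. $\mathcal{A}$ is the family of functions $f(z)=z+\sum_{n\ge2}a_nz^n$ analytic in $\mathbb{D}$. For $f(z)=z+\sum_{n\ge2} a_nz^n$ and $g(z)=z+\sum_{n\ge2} b_nz^n$ the Hadamard product is $f(z)*g(z)=z+\sum_{n\ge2}a_nb_nz^n$. For $\lambda>0$, $\mathcal{S}^*_\lambda=\{f\in\mathcal{A}:\ |zf'(z)/f(z)-1|<\lambda \text{ for all } z\in\mathbb{D}\}$ and $\mathcal{C}_\lambda=\{f\in\mathcal{A}:\ zf'(z)\in\mathcal{S}^*_\lambda\}$. For $\beta<1$, $\mathcal{R}(\beta)=\{f\in\mathcal{A}:\ \exists\,\varphi\in\mathbb{R}\text{ with } \mathrm{Re}[e^{i\varphi}(f'(z)-\beta)]>0\text{ for all }z\in\mathbb{D}\}$. Pochhammer symbol: $(x)_0=1$, $(x)_n=x(x+1)\cdots(x+n-1)$; generalized binomial coefficient $\binom{-x}{n}=(-1)^n(x)_n/n!$. ${}_5F_4(a_1,\dots,a_5;b_1,\dots,b_4;z)=\sum_{n\ge0}\frac{(a_1)_n\cdots(a_5)_n}{(b_1)_n\cdots(b_4)_n\,(1)_n}z^n$ for $|z|<1$; ${}_2F_1(p,q;r;z)=\sum_{k\ge0}\frac{(p)_k(q)_k}{(r)_k(1)_k}z^k$ for $|z|<1$, extended as usual by analytic continuation to $z=-1$. *)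

(* Defs.v *)
From HB Require Import structures.
From mathcomp Require Import all_boot all_order all_algebra.
From mathcomp Require Import all_classical all_reals all_analysis.
From mathcomp Require Import complex.

Set Implicit Arguments.
Unset Strict Implicit.
Unset Printing Implicit Defensive.

Import Order.TTheory GRing.Theory Num.Theory numFieldNormedType.Exports.

Local Open Scope classical_set_scope.
Local Open Scope ring_scope.

(* R[i] itself carries no topology; packed as a numClosedFieldType it inherits
   the one induced by the norm, and `derivable f z 1` is complex
   differentiability at z, with derivative `derive1 f z`. *)
Definition CC (R : realType) : numClosedFieldType := R[i].

Definition ofR (R : realType) (x : R) : CC R := (x%:C)%C.

(* The norm of R[i] takes its values in R[i]; this is the same modulus in R. *)
Definition modulus (R : realType) (z : CC R) : R := complex.Re `|z|.

Definition unit_disc (R : realType) : set (CC R) := [set z | modulus z < 1].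

(* The rising factorial (x)_n; not MathComp's falling factorial n ^_ m. *)
Definition pochhammer (K : pzRingType) (x : K) (n : nat) : K :=
  \prod_(k < n) (x + k%:R).

(* The generalized binomial coefficient "-x choose n". *)
Definition binomN (R : realType) (x : R) (n : nat) : R :=
  (-1) ^+ n * pochhammer x n / n`!%:R.

(* Euler's integral; convergent, hence meaningful, only for x > 0. *)
Definition Gamma (R : realType) (x : R) : R :=
  (\int[lebesgue_measure]_(t in `]0%R, +oo[) (t `^ (x - 1) * expR (- t)))%R.

Section ComplexFunctions.
Variable R : realType.
Local Notation C := (CC R).

Definition expands_as (u : nat -> C) (f : C -> C) : Prop :=
  forall z, unit_disc z -> series (fun n => u n * z ^+ n) @ \oo --> f z.

Definition classA (f : C -> C) : Prop :=
  exists u : nat -> C, [/\ u 0%N = 0, u 1%N = 1 & expands_as u f].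

(* Taylor coefficients at 0; they are unique whenever an expansion exists. *)
Definition coeffs (f : C -> C) : nat -> C :=
  xget (fun=> 0) [set u | expands_as u f].

Definition hadamard (f g : C -> C) (z : C) : C :=
  limn (series (fun n => coeffs f n * coeffs g n * z ^+ n)).

(* At z = 0 the quotient z f'(z) / f(z) is understood as its limit 1, so the
   inequality holds there for every lambda > 0; elsewhere f must not vanish. *)
Definition starlike (lambda : R) (f : C -> C) : Prop :=
  classA f /\
  forall z, unit_disc z -> z != 0 ->
    f z != 0 /\ modulus (z * derive1 f z / f z - 1) < lambda.

Definition convexC (lambda : R) (f : C -> C) : Prop :=
  classA f /\ starlike lambda (fun z => z * derive1 f z).

Definition expi (phi : R) : C := (cos phi +i* sin phi)%C.

Definition classR (beta : R) (f : C -> C) : Prop :=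
  classA f /\
  exists phi : R, forall z, unit_disc z ->
    0 < complex.Re (expi phi * (derive1 f z - ofR beta)).

(* The generalized hypergeometric series with numerator parameters ps and
   denominator parameters qs. *)
Definition hypergeometric (ps qs : seq C) (z : C) : C :=
  limn (series (fun n =>
    (\prod_(p <- ps) pochhammer p n)
    / ((\prod_(q <- qs) pochhammer q n) * pochhammer 1 n) * z ^+ n)).

Definition star_shaped (U : set C) : Prop :=
  forall z (t : R), U z -> 0 <= t <= 1 -> U (ofR t * z).

(* w is the value at z of the analytic continuation of 2F1(p, q; r; .) from
   the unit disc along the segment [0, z].  Two star-shaped domains meet in a
   star-shaped, hence connected, domain, so w is unique; for z outside
   [1, +oo[ it is the principal branch. *)
Definition continued_hyp2F1 (p q r z w : C) : Prop :=
  exists (U : set C) (F : C -> C),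
    [/\ open U, star_shaped U, @unit_disc R `<=` U & U z] /\
    [/\ forall x, U x -> derivable F x 1,
        forall x, unit_disc x -> F x = hypergeometric [:: p; q] [:: r] x
      & F z = w].

Definition hyp2F1 (p q r z : C) : C := xget 0 (continued_hyp2F1 p q r z).

Definition operatorI (a b c : C) (f : C -> C) : C -> C :=
  hadamard
    (fun z => z * hypergeometric
       [:: a; b / 4; (b + 1) / 4; (b + 2) / 4; (b + 3) / 4]
       [:: c / 4; (c + 1) / 4; (c + 2) / 4; (c + 3) / 4] z)
    f.

End ComplexFunctions.

(* 2F1(p, q; r; -1) for real parameters; the value is then a real number. *)
Definition hyp2F1_at_N1 (R : realType) (p q r : R) : R :=
  complex.Re (hyp2F1 (ofR p) (ofR q) (ofR r) (-1)).

(* Main.v *)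
(* For f(z) = z + sum u_n z^n in R(beta), Caratheodory's coefficient bound gives
   n |u_n| <= 2 (1 - beta), and with the coefficients (a)_n (b)_4n / (n! (c)_4n)
   of the 5F4 kernel the membership of I(f) in C_lambda follows from
     sum_(n >= 1) (n + 1 + lambda) (A)_n (B)_4n / (n! (c)_4n)
       <= lambda / (2 (1 - beta)),   A = |a|, B = |b|.
   The quotient (B)_k / (c)_k is a multiple of the beta integral
   int t^(B + k - 1) (1 - t)^(c - B - 1) dt, so the sums are integrals against
   (1 - t^4)^(-A) = (1 - t)^(-A) (1 + t)^(-A) (1 + t^2)^(-A).  Expanding the last
   factor in powers of t^2 gives alternating sums whose terms are Euler integrals
   of 2F1 at -1; the partial sums of odd length are upper bounds, so no
   interchange of limit and integral is needed and the convergent series of the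
   hypothesis dominate.

   The value 2F1(p, q; q + s; -1) is a series in powers of 1 + z obtained by
   expanding (1 - t z)^(-p) = (2 - (1 + t z))^(-p) in powers of (1 + t z) / 2 and
   then recentering; it converges for |1 + z| < 2 and agrees with the
   hypergeometric series on the unit disc.  Integrals over (0, 1) are carried out
   on (0, +oo) through t = 1 / (1 + w). *)
Require Import Defs.
From HB Require Import structures.
From mathcomp Require Import all_boot all_order all_algebra.
From mathcomp Require Import all_classical all_reals all_analysis.
From mathcomp Require Import separable cyclotomic measurable_realfun complex ring lra zify.
Set Implicit Arguments.
Unset Strict Implicit.
Import Order.TTheory GRing.Theory Num.Theory numFieldNormedType.Exports.
Local Open Scope classical_set_scope.
Local Open Scope ring_scope.

(** * The real-valued modulus and the embedding of [R] into [CC R] *)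

Section Modulus.
Variable R : realType.
Local Notation C := (CC R).
Implicit Types (z w : C) (x : R).

(** The hypothesis matches the coefficient sum piece by piece. The coefficient criterion for the
    class of [lambda]-starlike functions gives the k-th coefficient the weight [k - 1 + lambda].
    Applied to [z I(f)'] at [k = n + 2], it produces [n + 1 + lambda], while the factor [n + 2] from
    the derivative is the one that Caratheodory's bound controls. In the part weighted by [n + 1],
    this factor cancels against [(n + 1)!] and raises [A] to [A + 1], the index [4 (n + 1)] raises
    [B] to [B + 4], and absorbing [(1 - t)^(- A - 1)] into the beta density leaves the parameter
    [c - A - B - 1], positive by assumption. In the part weighted by [lambda], the term [n = 0]
    equals [lambda] and accounts for the 1 in [1 + 1 / (2 (1 - beta))].

    The expansion of [(1 + t^2)^(- A)] is at the edge of its convergence at [t = 1], so only its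
    truncations are integrated; the assumed convergence of the two series serves to pass to their
    limits.

    Taylor coefficients are extracted by averages over roots of unity: finite sums whose aliasing
    error is an explicit tail. *)

Lemma normCE z : `|z| = ofR (modulus z).
Proof. by rewrite /modulus /ofR; case: z => a b; rewrite normc_def. Qed.

Lemma ofR_inj : injective (@ofR R).
Proof. by move=> x y []. Qed.

Lemma ofRD x y : ofR (x + y) = ofR x + ofR y.
Proof. exact: (rmorphD (real_complex R)). Qed.
Lemma ofRM x y : ofR (x * y) = ofR x * ofR y.
Proof. exact: (rmorphM (real_complex R)). Qed.
Lemma ofRX x n : ofR (x ^+ n) = ofR x ^+ n.
Proof. exact: (rmorphXn (real_complex R)). Qed.
Lemma ofRV x : ofR x^-1 = (ofR x)^-1.
Proof. exact: (fmorphV (real_complex R)). Qed.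
Lemma ofR_nat n : ofR n%:R = n%:R :> C.
Proof. exact: (rmorph_nat (real_complex R)). Qed.
Lemma ofR0 : ofR 0 = 0 :> C. Proof. by []. Qed.
Lemma ofR1 : ofR 1 = 1 :> C. Proof. by []. Qed.
Lemma ofRN x : ofR (- x) = - ofR x.
Proof. exact: (rmorphN (real_complex R)). Qed.
Lemma ofR_sum I (r : seq I) (P : pred I) (F : I -> R) :
  ofR (\sum_(i <- r | P i) F i) = \sum_(i <- r | P i) ofR (F i).
Proof. exact: (rmorph_sum (real_complex R)). Qed.
Lemma ofR_prod I (r : seq I) (P : pred I) (F : I -> R) :
  ofR (\prod_(i <- r | P i) F i) = \prod_(i <- r | P i) ofR (F i).
Proof. exact: (rmorph_prod (real_complex R)). Qed.

Lemma ler_ofR x y : (ofR x <= ofR y) = (x <= y).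
Proof. exact: lecR. Qed.
Lemma ltr_ofR x y : (ofR x < ofR y) = (x < y).
Proof. exact: ltcR. Qed.

Lemma modulus_ge0 z : 0 <= modulus z.
Proof. by rewrite -ler_ofR -normCE normr_ge0. Qed.
Hint Resolve modulus_ge0 : core.

Lemma modulusM z w : modulus (z * w) = modulus z * modulus w.
Proof. by apply: ofR_inj; rewrite ofRM -!normCE normrM. Qed.
Lemma modulusX z n : modulus (z ^+ n) = modulus z ^+ n.
Proof. by apply: ofR_inj; rewrite ofRX -!normCE normrX. Qed.
Lemma modulusV z : modulus z^-1 = (modulus z)^-1.
Proof. by apply: ofR_inj; rewrite ofRV -!normCE normfV. Qed.
Lemma modulusD z w : modulus (z + w) <= modulus z + modulus w.
Proof. by rewrite -ler_ofR ofRD -!normCE ler_normD. Qed.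
Lemma modulusN z : modulus (- z) = modulus z.
Proof. by apply: ofR_inj; rewrite -!normCE normrN. Qed.
Lemma modulusB z w : modulus (z - w) <= modulus z + modulus w.
Proof. by rewrite -(modulusN w) modulusD. Qed.
Lemma modulus_distC z w : modulus (z - w) = modulus (w - z).
Proof. by rewrite -modulusN opprB. Qed.
Lemma modulus_ofR x : modulus (ofR x) = `|x|.
Proof. by rewrite /modulus /ofR normc_def /= expr0n addr0 sqrtr_sqr. Qed.
Lemma modulus0 : modulus (0 : C) = 0.
Proof. by rewrite -ofR0 modulus_ofR normr0. Qed.
Lemma modulus1 : modulus (1 : C) = 1.
Proof. by rewrite -ofR1 modulus_ofR normr1. Qed.
Lemma modulus_nat n : modulus (n%:R : C) = n%:R.
Proof. by rewrite -ofR_nat modulus_ofR normr_nat. Qed.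
Lemma modulus_eq0 z : (modulus z == 0) = (z == 0).
Proof. by rewrite -[RHS]normr_eq0 normCE -ofR0 (inj_eq ofR_inj). Qed.
Lemma modulus_gt0 z : (0 < modulus z) = (z != 0).
Proof. by rewrite lt0r modulus_ge0 andbT modulus_eq0. Qed.
Lemma modulus_sum I (r : seq I) (P : pred I) (F : I -> C) :
  modulus (\sum_(i <- r | P i) F i) <= \sum_(i <- r | P i) modulus (F i).
Proof.
elim/big_rec2 : _ => [|i y x _ le]; first by rewrite modulus0.
by rewrite (le_trans (modulusD _ _))// lerD2l.
Qed.
Lemma modulus_prod I (r : seq I) (P : pred I) (F : I -> C) :
  modulus (\prod_(i <- r | P i) F i) = \prod_(i <- r | P i) modulus (F i).
Proof. exact: (big_morph _ modulusM modulus1). Qed.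

Lemma modulus_Re z : `|complex.Re z| <= modulus z.
Proof. by rewrite -ler_ofR -normCE; exact: normc_ge_Re. Qed.
Lemma modulus_Im z : `|complex.Im z| <= modulus z.
Proof.
case: z => a b; rewrite /modulus normc_def /= -sqrtr_sqr.
by rewrite ler_wsqrtr// lerDr sqr_ge0.
Qed.
Lemma complex_split z :
  z = ofR (complex.Re z) + (0 +i* 1)%C * ofR (complex.Im z) :> C.
Proof. by rewrite {1}[z]complexE. Qed.

Lemma modulus_le_ReIm z : modulus z <= `|complex.Re z| + `|complex.Im z|.
Proof.
rewrite {1}[z]complex_split (le_trans (modulusD _ _))// modulusM !modulus_ofR.
rewrite [modulus _](_ : _ = 1) ?mul1r//.
by rewrite /modulus normc_def /= expr0n expr1n add0r sqrtr1.
Qed.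
End Modulus.
#[local] Hint Extern 0 (is_true (_ <= modulus _)) => exact: modulus_ge0 : core.

(** * Complex limits, power series and their termwise differentiation *)

Section ComplexSeries.
Variable R : realType.
Local Notation C := (CC R).
Implicit Types (z w : C) (u : nat -> C) (l : C).

(** The norm of [CC R] is complex-valued, so the radii of its topology are positive complex numbers;
    positivity in [R[i]] forces a zero imaginary part, hence every radius comes from [R]. Complex
    limits are thereby reduced to real ones. *)
Lemma cvg_modulusP {T : Type} (F : set_system T) {FF : Filter F} (f : T -> C) l :
  f @ F --> l <-> (fun n => modulus (f n - l)) @ F --> (0 : R).
Proof.
split=> [/cvgrPdist_lt fl|/cvgrPdist_lt fl]; apply/cvgrPdist_lt => e e0.
  have : 0 < ofR e by rewrite -ofR0 ltr_ofR.
  move=> /fl; apply: filterS => n; rewrite normCE ltr_ofR sub0r normrN.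
  by rewrite (ger0_norm (modulus_ge0 _)) modulus_distC.
have [Ie e0'] : complex.Im e = 0 /\ 0 < complex.Re e.
  by move: e0; rewrite ltcE /= => /andP[/eqP].
have eE : e = ofR (complex.Re e) by move: Ie; case: e {e0 e0'} => x y /= ->.
rewrite eE; move: e0' => /fl; apply: filterS => n.
by rewrite normCE ltr_ofR sub0r normrN (ger0_norm (modulus_ge0 _)) modulus_distC.
Qed.

Lemma cvg_le0 {T : Type} (F : set_system T) {FF : Filter F} (f g : T -> R) :
  (forall n, 0 <= f n <= g n) -> g @ F --> (0 : R) -> f @ F --> (0 : R).
Proof.
move=> fg /cvgrPdist_lt g0; apply/cvgrPdist_lt => e /g0.
apply: filterS => n; rewrite !sub0r !normrN; apply: le_lt_trans.
have /andP[f0 fgn] := fg n; rewrite !ger0_norm//; exact: le_trans fgn.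
Qed.

Lemma cvg_CReIm u (a b : R) :
  (fun n => complex.Re (u n)) @ \oo --> a ->
  (fun n => complex.Im (u n)) @ \oo --> b ->
  u @ \oo --> ((a +i* b)%C : C).
Proof.
move=> ha hb; apply/cvg_modulusP.
apply: (@cvg_le0 _ _ _ _
  (fun n => `|complex.Re (u n) - a| + `|complex.Im (u n) - b|)).
  move=> n; rewrite modulus_ge0 /= (le_trans (modulus_le_ReIm _))//.
  by case: (u n).
rewrite -[0]addr0; apply: cvgD.
  by apply/norm_cvg0P; rewrite -(subrr a); apply: cvgB => //; exact: cvg_cst.
by apply/norm_cvg0P; rewrite -(subrr b); apply: cvgB => //; exact: cvg_cst.
Qed.

Lemma cvg_modulus {T : Type} (F : set_system T) {FF : Filter F} (f : T -> C) l :
  f @ F --> l -> (fun n => modulus (f n)) @ F --> modulus l.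
Proof.
move=> /cvg_modulusP fl; apply/subr_cvg0/norm_cvg0P; apply: cvg_le0 fl => n.
have h1 := modulusD (f n - l) l; have h2 := modulusD (l - f n) (f n).
rewrite !subrK (modulus_distC l) in h1 h2.
by rewrite normr_ge0 /= ler_norml; apply/andP; split; lra.
Qed.

(** Completeness is inherited from [R]: real and imaginary parts are dominated termwise by the
    moduli, and their two limits are glued. *)
Lemma abs_summable_cvg u :
  cvgn (series (fun n => modulus (u n))) -> cvgn (series u).
Proof.
move=> su.
have cv (p : C -> R) : (forall z, `|p z| <= modulus z) ->
    {morph p : x y / x + y} -> p 0 = 0 -> cvgn (fun n => p (series u n)).
  move=> pm pD p0.
  rewrite (_ : (fun n => _) = series (fun n => p (u n))).
    by apply: normed_cvg; apply: series_le_cvg su => //= n.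
  by apply/funext => n; rewrite /series /= (big_morph p pD p0).
have /cvg_ex[a ha] := cv _ (@modulus_Re R) (raddfD (@complex.Re R)) erefl.
have /cvg_ex[b hb] := cv _ (@modulus_Im R) (raddfD (@complex.Im R)) erefl.
by apply/cvg_ex; exists (a +i* b)%C; exact: cvg_CReIm ha hb.
Qed.

Lemma modulus_lim_le u l (S : nat -> R) (s : R) : u @ \oo --> l -> S @ \oo --> s ->
  (forall n, modulus (u n) <= S n) -> modulus l <= s.
Proof.
move=> /cvg_modulus ul Ss uS; rewrite -(cvg_lim (@norm_hausdorff _ _) ul).
rewrite -(cvg_lim (@norm_hausdorff _ _) Ss); apply: ler_lim.
- by apply/cvg_ex; exists (modulus l).
- by apply/cvg_ex; exists s.
- by near=> n; exact: uS.
Unshelve. all: by end_near. Qed.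

(** Abel's criterion in place of a radius of convergence at least [r]; it is stable under shifts and
    under multiplication by [n]. *)
Definition pow_bounded (r : R) u :=
  forall rho, 0 <= rho < r -> exists M, forall n, modulus (u n) * rho ^+ n <= M.

(** Each of the [n] powers [x ^ i], [i < n], is at least [x ^ n], so the product stays below a
    partial geometric sum. *)
Lemma linear_geometric_bounded (x : R) : 0 <= x < 1 ->
  exists M, forall n, n%:R * x ^+ n <= M.
Proof.
move=> /andP[x0 x1]; exists (1 - x)^-1 => n.
have x1' : 0 < 1 - x by rewrite subr_gt0.
rewrite -[leRHS]mul1r ler_pdivlMr//.
have : (1 - x) * \sum_(i < n) x ^+ i <= 1.
  by rewrite -opprB mulNr -subrX1 opprB lerBlDr lerDl exprn_ge0.
apply: le_trans; rewrite mulrC (ler_wpM2l (ltW x1'))//.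
have -> : n%:R * x ^+ n = \sum_(i < n) x ^+ n.
  by rewrite sumr_const card_ord mulr_natl.
apply: ler_sum => i _.
exact: (ler_wiXn2l x0 (ltW x1) (ltnW (ltn_ord i))).
Qed.

(** The bound holds at an intermediate radius [s], and the surplus [(rho / s) ^ n] absorbs the
    factor [n]. *)
Lemma pow_bounded_nat r u : pow_bounded r u -> pow_bounded r (fun n => n%:R * u n).
Proof.
move=> ub rho /andP[rho0 rhor].
have [rhoz|rhoN] := eqVneq rho 0.
  exists 0 => n; rewrite rhoz modulusM modulus_nat.
  by case: n => [|n]; rewrite ?mul0r// expr0n/= mulr0.
have rhop : 0 < rho by rewrite lt0r rhoN.
pose s := (rho + r) / 2.
have [rs sr] : rho < s /\ s < r by rewrite /s; split; lra.
have s0 : 0 < s by exact: lt_trans rs.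
have [|M hM] := ub s; first by rewrite ltW.
have [|K hK] := @linear_geometric_bounded (rho / s).
  by rewrite divr_ge0 ?ltW//= ltr_pdivrMr// mul1r.
exists (K * M) => n; rewrite modulusM modulus_nat.
have -> : n%:R * modulus (u n) * rho ^+ n =
          n%:R * (rho / s) ^+ n * (modulus (u n) * s ^+ n).
  have sn : s ^+ n != 0 by rewrite expf_neq0// gt_eqF.
  rewrite exprMn exprVn; field.
  exact: sn.
have q0 : 0 <= rho / s by rewrite divr_ge0// ltW.
have s0' := ltW s0.
by apply: ler_pM => //; rewrite mulr_ge0 ?modulus_ge0 ?exprn_ge0.
Qed.

Lemma pow_bounded_shift r u : 0 < r -> pow_bounded r u -> pow_bounded r (fun n => u n.+1).
Proof.
move=> r0 ub rho /andP[rho0 rhor].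
pose s := (rho + r) / 2.
have [rs sr] : rho < s /\ s < r by rewrite /s; split; lra.
have s0 : 0 < s by exact: le_lt_trans rs.
have [|M hM] := ub s; first by rewrite ltW.
exists (M / s) => n; rewrite ler_pdivlMr// (le_trans _ (hM n.+1))//.
rewrite -mulrA; apply: ler_wpM2l => //; rewrite [s ^+ n.+1]exprSr.
by apply: ler_wpM2r; [exact: ltW|apply: lerXn2r; rewrite ?nnegrE// ltW].
Qed.

Lemma pow_bounded_summable r u rho : pow_bounded r u -> 0 <= rho < r ->
  cvgn (series (fun n => modulus (u n) * rho ^+ n)).
Proof.
move=> ub /andP[rho0 rhor].
pose s := (rho + r) / 2.
have [rs sr] : rho < s /\ s < r by rewrite /s; split; lra.
have s0 : 0 < s by exact: le_lt_trans rs.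
have [|M hM] := ub s; first by rewrite ltW.
apply: (@series_le_cvg _ _ (fun n => geometric M (rho / s) n)).
- by move=> n; rewrite mulr_ge0 ?exprn_ge0.
- move=> n; rewrite /geometric/= mulr_ge0//.
    by rewrite (le_trans _ (hM 0%N))// mulr_ge0// exprn_ge0// ltW.
  by rewrite exprn_ge0// divr_ge0// ltW.
- move=> n; rewrite /geometric/= exprMn exprVn mulrA mulrAC.
  rewrite ler_wpM2r ?exprn_ge0// ler_pdivlMr ?exprn_gt0//.
- apply: is_cvg_geometric_series.
  have q0 : 0 <= rho / s by rewrite divr_ge0// ltW.
  by rewrite (ger0_norm q0) ltr_pdivrMr// mul1r.
Qed.

Definition psum u z : C := limn (series (fun n => u n * z ^+ n)).

Lemma pow_bounded_cvg r u z : pow_bounded r u -> modulus z < r ->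
  series (fun n => u n * z ^+ n) @ \oo --> psum u z.
Proof.
move=> ub zr; apply: abs_summable_cvg.
under eq_fun do rewrite modulusM modulusX.
by apply: pow_bounded_summable ub _; rewrite modulus_ge0.
Qed.

Lemma expands_pow_bounded u f : expands_as u f -> pow_bounded 1 u.
Proof.
move=> uf rho /andP[rho0 rho1].
have dz : unit_disc (ofR rho) by rewrite /unit_disc/= modulus_ofR ger0_norm.
have /cvgP/cvg_series_cvg_0/cvg_modulus := uf _ dz.
rewrite modulus0 => /cvgP/cvg_has_ub[M hM]; exists M => n.
apply: le_trans (hM _ _); last by exists n.
by rewrite (ger0_norm (modulus_ge0 _)) modulusM modulusX modulus_ofR (ger0_norm rho0).
Qed.

Lemma expands_psum u f z : expands_as u f -> unit_disc z -> f z = psum u z.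
Proof. by move=> uf /uf /(cvg_lim (@norm_hausdorff _ _)). Qed.

Lemma pow_bounded_expands u : pow_bounded 1 u -> expands_as u (psum u).
Proof. by move=> ub z; exact: pow_bounded_cvg. Qed.

(** Made for power series: a quadratic remainder bound can be summed termwise before any limit in
    [h] is taken. *)
Lemma is_derive_quadratic (f : C -> C) z l (K d : R) : 0 < d ->
  (forall h, modulus h < d ->
     modulus (f (h + z) - f z - h * l) <= K * modulus h ^+ 2) ->
  is_derive z (1 : C) f l.
Proof.
move=> d0 hf.
suff fl : h^-1 *: (f (h *: 1 + z) - f z) @[h --> 0^'] --> l.
  split; first by apply/cvg_ex; exists l.
  exact: cvg_lim fl.
apply/cvgrPdist_lt => e e0.
have e0' : 0 < modulus e by rewrite modulus_gt0 gt_eqF.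
have eE : e = ofR (modulus e) by rewrite -normCE gtr0_norm.
near=> h.
have h0 : h != 0 by near: h; exact: nbhs_dnbhs_neq.
have hd : modulus h < d.
  near: h; apply: nbhs_dnbhs; apply/nbhs_ballP; exists (ofR d) => /=.
    by rewrite -ofR0 ltr_ofR.
  by move=> y; rewrite /ball/= sub0r normrN normCE ltr_ofR.
have hK : (`|K| + 1) * modulus h < modulus e.
  near: h; apply: nbhs_dnbhs; apply/nbhs_ballP.
  have K1 : 0 < `|K| + 1 by rewrite ltr_wpDl.
  exists (ofR (modulus e / (`|K| + 1))) => /=.
    by rewrite -ofR0 ltr_ofR divr_gt0.
  move=> y; rewrite /ball/= sub0r normrN normCE ltr_ofR.
  by rewrite ltr_pdivlMr// mulrC.
rewrite eE normCE ltr_ofR; apply: le_lt_trans hK.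
have -> : l - h^-1 *: (f (h *: 1 + z) - f z) =
  - (f (h + z) - f z - h * l) / h.
  rewrite /GRing.scale/= mulr1 mulNr mulrBl [h * l]mulrC mulfK// opprB.
  by rewrite [h^-1 * _]mulrC.
have mh : 0 < modulus h by rewrite modulus_gt0.
rewrite modulusM modulusV modulusN ler_pdivrMr// (le_trans (hf _ hd))//.
rewrite expr2 mulrA ler_wpM2r// ler_wpM2r//.
by rewrite (le_trans (ler_norm _))// lerDl.
Unshelve. all: by end_near. Qed.

(** The remainder obeys [R_(n+1) = (h + z) R_n + n h^2 z^(n-1)], and [n^2 + n <= (n + 1)^2] closes
    the induction. The factor [rho ^+ 2] on the left avoids the exponent [n - 2]. *)
Lemma expr_taylor1 z h (rho : R) n : 0 < rho -> modulus z <= rho ->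
  modulus (h + z) <= rho ->
  modulus ((h + z) ^+ n - z ^+ n - n%:R * h * z ^+ n.-1) * rho ^+ 2
  <= n%:R ^+ 2 * modulus h ^+ 2 * rho ^+ n.
Proof.
move=> rho0 zr hr; elim: n => [|n IH].
  by rewrite !expr0 subrr !mul0r subr0 modulus0 !expr2 !mul0r.
have zn : modulus (n%:R * h ^+ 2 * z ^+ n.-1) * rho ^+ 2 <=
    n%:R * modulus h ^+ 2 * rho ^+ n.+1.
  rewrite !modulusM modulus_nat !modulusX.
  case: n {IH} => [|n]; first by rewrite !mul0r.
  rewrite -mulrA; apply: ler_wpM2l; first by rewrite !mulr_ge0.
  rewrite -[n.+2]addn2 exprD; apply: ler_wpM2r; first by rewrite exprn_ge0// ltW.
  by apply: lerXn2r; rewrite ?nnegrE// ltW.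
have -> : (h + z) ^+ n.+1 - z ^+ n.+1 - n.+1%:R * h * z ^+ n.+1.-1 =
  (h + z) * ((h + z) ^+ n - z ^+ n - n%:R * h * z ^+ n.-1) +
  n%:R * h ^+ 2 * z ^+ n.-1.
  rewrite /= !exprS; case: n {IH zn} => [|n]; rewrite ?exprS/=; last by ring.
  by rewrite !expr0; ring.
move: IH zn; set D := _ - _ - _; set E := n%:R * h ^+ 2 * _ => IH zn.
have hD : modulus ((h + z) * D) * rho ^+ 2 <=
    rho * (n%:R ^+ 2 * modulus h ^+ 2 * rho ^+ n).
  rewrite modulusM -[leLHS]mulrA; apply: ler_pM => //.
  by rewrite mulr_ge0// exprn_ge0// ltW.
have hDE : modulus ((h + z) * D + E) * rho ^+ 2 <=
    (modulus ((h + z) * D) + modulus E) * rho ^+ 2.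
  by apply: ler_wpM2r (modulusD _ _); rewrite exprn_ge0// ltW.
apply: (le_trans hDE); rewrite mulrDl (le_trans (lerD hD zn))//.
have -> : rho * (n%:R ^+ 2 * modulus h ^+ 2 * rho ^+ n) +
  n%:R * modulus h ^+ 2 * rho ^+ n.+1 =
  (n%:R ^+ 2 + n%:R) * (modulus h ^+ 2 * rho ^+ n.+1) by rewrite (exprS rho n); ring.
rewrite -[leRHS]mulrA; apply: ler_wpM2r.
  by rewrite mulr_ge0// exprn_ge0// ltW.
rewrite -natr1; have := ler0n R n; nra.
Qed.

Definition diff_coef u (n : nat) : C := n.+1%:R * u n.+1.

Lemma pow_bounded_diff r u : 0 < r -> pow_bounded r u -> pow_bounded r (diff_coef u).
Proof. by move=> r0 /pow_bounded_nat /(pow_bounded_shift r0). Qed.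

(** Summing [expr_taylor1] bounds the remainder by [|h|^2 / rho^2] times the sum of
    [n^2 |u n| rho^n], finite for [rho] halfway between [modulus z] and [r]. The restriction
    [|h| < rho - |z|] keeps [h + z] within radius [rho]. *)
Lemma psum_is_derive r u z : pow_bounded r u -> modulus z < r ->
  is_derive z (1 : C) (psum u) (psum (diff_coef u) z).
Proof.
move=> ub zr.
have r0 : 0 < r by exact: le_lt_trans zr.
pose rho := (modulus z + r) / 2.
have mz := modulus_ge0 z.
have [zrho rhor] : modulus z < rho /\ rho < r by rewrite /rho; split; lra.
have rho0 : 0 < rho by exact: le_lt_trans zrho.
have ub2 := pow_bounded_nat (pow_bounded_nat ub).
have /(pow_bounded_summable ub2) /cvg_ex[K hK] : 0 <= rho < r by rewrite ltW.
apply: (@is_derive_quadratic _ _ _ (K / rho ^+ 2) (rho - modulus z)).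
  by rewrite subr_gt0.
move=> h hd.
have hz : modulus (h + z) < rho.
  by rewrite (le_lt_trans (modulusD _ _))// -ltrBrDr.
have c1 := pow_bounded_cvg ub (lt_trans hz rhor).
have c2 := pow_bounded_cvg ub zr.
have c3 := pow_bounded_cvg (pow_bounded_diff r0 ub) zr.
have {}c3 : series (fun n => n%:R * u n * z ^+ n.-1) @ \oo --> psum (diff_coef u) z.
  rewrite -cvg_shiftS; apply: cvg_trans c3; apply: near_eq_cvg.
  near=> n; rewrite /series/= big_nat_recl//= !mul0r add0r.
  by apply: eq_bigr.
have c4 : (fun n => \sum_(0 <= i < n)
    u i * ((h + z) ^+ i - z ^+ i - i%:R * h * z ^+ i.-1)) @ \oo -->
    psum u (h + z) - psum u z - h * psum (diff_coef u) z.
  apply: cvg_trans (cvgB (cvgB c1 c2) (cvgM (cvg_cst h) c3)).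
  apply: near_eq_cvg; near=> n.
  rewrite !fctE /series/= mulr_sumr -!sumrB; apply: eq_bigr => i _; ring.
apply: modulus_lim_le c4 _ _.
  exact: cvgM (cvgM hK (cvg_cst _)) (cvg_cst (modulus h ^+ 2)).
move=> n; rewrite /series/= !mulr_suml.
rewrite (le_trans (modulus_sum _ _ _))//; apply: ler_sum => i _.
have rho2 : 0 < rho ^+ 2 by rewrite exprn_gt0.
rewrite [leRHS]mulrAC ler_pdivlMr// !modulusM !modulus_nat -[leLHS]mulrA.
have -> : i%:R * (i%:R * modulus (u i)) * rho ^+ i * modulus h ^+ 2 =
  modulus (u i) * (i%:R ^+ 2 * modulus h ^+ 2 * rho ^+ i) by ring.
by apply: ler_wpM2l => //; apply: expr_taylor1 => //; exact: ltW.
Unshelve. all: by end_near. Qed.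
Lemma ge_cvg (S : nat -> R) (x s : R) : S @ \oo --> s -> (forall n, x <= S n) -> x <= s.
Proof.
move=> Ss xS; rewrite -(cvg_lim (@norm_hausdorff _ _) Ss); apply: limr_ge.
  by apply/cvg_ex; exists s.
exact: nearW.
Qed.

Lemma le_cvg (S : nat -> R) (x s : R) : S @ \oo --> s -> (forall n, S n <= x) -> s <= x.
Proof.
move=> Ss xS; rewrite -(cvg_lim (@norm_hausdorff _ _) Ss); apply: limr_le.
  by apply/cvg_ex; exists s.
exact: nearW.
Qed.

(** * Taylor coefficients from averages over roots of unity *)

Lemma prim_root_sum (w : C) (N m : nat) : N.-primitive_root w ->
  \sum_(j < N) w ^+ (j * m) = if (N %| m)%N then N%:R else 0.
Proof.
move=> hw; case: ifPn => [|dm].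
  move=> /dvdnP[q ->]; rewrite (eq_bigr (fun=> 1)) ?sumr_const ?card_ord//.
  by move=> j _; rewrite mulnA exprM -exprAC (prim_expr_order hw) expr1n.
under eq_bigr do rewrite mulnC exprM.
have w1 : w ^+ m - 1 != 0 by rewrite subr_eq0 -(prim_order_dvd hw).
apply: (mulfI w1); rewrite -subrX1 mulr0 -exprM mulnC exprM.
by rewrite (prim_expr_order hw) expr1n subrr.
Qed.

(** ['X^N - 1] splits into distinct linear factors, and a set of [N] distinct N-th roots of unity
    contains a primitive one. *)
Lemma primitive_root_exists N : (0 < N)%N -> exists w : C, N.-primitive_root w.
Proof.
move=> N0; pose p : {poly C} := 'X^N - 1.
have [rs Dp] := closed_field_poly_normal p.
rewrite (monicP _) ?monicXnsubC// scale1r in Dp.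
have rN1 : all N.-unity_root rs by apply/allP => z; rewrite -root_prod_XsubC -Dp.
have sz : (N < (size rs).+1)%N.
  by rewrite -(size_prod_XsubC rs id) -Dp size_XnsubC.
have [|z] := hasP (cyclic.has_prim_root N0 rN1 _ sz); last by exists z.
by rewrite -separable_prod_XsubC -Dp separable_Xn_sub_1// pnatr_eq0 -lt0n.
Qed.

Lemma modulus_unity_root (w : C) N : (0 < N)%N -> w ^+ N = 1 -> modulus w = 1.
Proof.
move=> N0 wN; apply/eqP; rewrite -(@pexpr_eq1 _ _ N)// -?lt0n//.
by rewrite -modulusX wN modulus1.
Qed.

(** The sum of [|u n| r^n] over [n >= K], which measures the aliasing error of the averages
    below. *)
Definition abs_tail u (r : R) K : R :=
  let a := fun n => modulus (u n) * r ^+ n in limn (series a) - series a K.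

Lemma abs_tail_cvg0 u (f : C -> C) (r : R) : expands_as u f -> 0 <= r < 1 ->
  abs_tail u r @ \oo --> 0.
Proof.
move=> /expands_pow_bounded ub r01; have := pow_bounded_summable ub r01.
rewrite /abs_tail; set a := fun n => _ => ca.
by rewrite -(subrr (limn (series a))); apply: cvgB ca; exact: cvg_cst.
Qed.

(** A discrete Fourier coefficient on the circle of radius [r], in the role of Cauchy's integral. By
    orthogonality it retains the terms [u k * r^k] with [N] dividing [m + k]: [m = N - n] isolates
    the n-th coefficient, and [m = n] probes the index [- n], where only aliasing is left. *)
Definition root_mean (f : C -> C) (r : R) (w : C) (N m : nat) : C :=
  N%:R^-1 * \sum_(j < N) w ^+ (j * m) * f (ofR r * w ^+ j).

(** Averaging the truncation at [n + K] termwise leaves the indices selected by [prim_root_sum];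
    those from [K] on are dominated by the absolute tail, and the bound passes to the limit. *)
Lemma root_mean_le u (f : C -> C) (r : R) N m K (w : C) :
  expands_as u f -> 0 < r < 1 -> N.-primitive_root w ->
  modulus (root_mean f r w N m -
    \sum_(0 <= k < K | (N %| m + k)%N) u k * ofR r ^+ k)
  <= abs_tail u r K.
Proof.
move=> uf /andP[r0 r1] hw; rewrite /abs_tail; set a := fun n => modulus (u n) * r ^+ n.
have N0 := prim_order_gt0 hw.
have Nu : N%:R != 0 :> C by rewrite pnatr_eq0 -lt0n.
have a0 n : 0 <= a n by rewrite mulr_ge0// exprn_ge0// ltW.
have ca : cvgn (series a).
  by apply: pow_bounded_summable (expands_pow_bounded uf) _; rewrite ltW.
have cU : (fun n => N%:R^-1 * \sum_(j < N) w ^+ (j * m) *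
    series (fun k => u k * (ofR r * w ^+ j) ^+ k) (n + K)%N -
    \sum_(0 <= k < K | (N %| m + k)%N) u k * ofR r ^+ k) @ \oo -->
    root_mean f r w N m - \sum_(0 <= k < K | (N %| m + k)%N) u k * ofR r ^+ k.
  apply: cvgB (cvg_cst _); apply: cvgM; first exact: cvg_cst.
  apply: cvg_big => [|j _]; first exact: add_continuous.
  apply: cvgM; first exact: cvg_cst.
  rewrite (cvg_shiftn K); apply: uf; rewrite /unit_disc/= modulusM modulusX.
  rewrite modulus_ofR (modulus_unity_root N0 (prim_expr_order hw)) expr1n mulr1.
  by rewrite gtr0_norm.
apply: (modulus_lim_le cU).
  by apply: (@cvgB _ _ _ _ _ (fun n => series a (n + K)%N) (fun=> series a K));
    [rewrite (cvg_shiftn K); exact: ca|exact: cvg_cst].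
move=> n.
have -> : N%:R^-1 * \sum_(j < N) w ^+ (j * m) *
    series (fun k => u k * (ofR r * w ^+ j) ^+ k) (n + K)%N =
    \sum_(0 <= k < n + K | (N %| m + k)%N) u k * ofR r ^+ k.
  rewrite /series/= mulr_sumr.
  under [LHS]eq_bigr do rewrite !mulr_sumr.
  rewrite exchange_big/= [RHS]big_mkcond/=; apply: eq_bigr => k _.
  have -> : (if (N %| m + k)%N then u k * ofR r ^+ k else 0) =
    u k * ofR r ^+ k * N%:R^-1 * (if (N %| m + k)%N then N%:R else 0).
    by case: ifP; rewrite ?mulr0// mulfVK.
  rewrite -(prim_root_sum _ hw) mulr_sumr; apply: eq_bigr => j _.
  by rewrite mulnDr exprD exprMn -exprM; ring.
rewrite (@big_cat_nat _ _ _ K 0%N (n + K)%N)//= ?leq_addl//.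
rewrite addrAC subrr add0r (le_trans (modulus_sum _ _ _))//.
rewrite -[leRHS]/(series a (n + K)%N - series a K) series_addn.
rewrite addrAC subrr add0r big_mkcond/=; apply: ler_sum => k _.
case: ifP => // _; rewrite modulusM modulusX modulus_ofR gtr0_norm//.
Qed.

(** For [k < N], [N] divides [N - n + k] only when [k = n]. *)
Lemma root_mean_coef u (f : C -> C) (r : R) n N w : expands_as u f -> 0 < r < 1 ->
  N.-primitive_root w -> (n < N)%N ->
  modulus (root_mean f r w N (N - n) - u n * ofR r ^+ n)
  <= abs_tail u r N.
Proof.
move=> uf r01 hw nN.
suff -> : u n * ofR r ^+ n =
    \sum_(0 <= k < N | (N %| (N - n) + k)%N) u k * ofR r ^+ k.
  exact: root_mean_le.
rewrite big_mkord (bigD1 (Ordinal nN))/= ?subnK ?(ltnW nN)//.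
rewrite big1 ?addr0// => i /andP[dvd /eqP ni].
exfalso; apply: ni; apply: val_inj => /=.
have := ltn_ord i; move: dvd => /dvdnP[q].
case: q => [|[|q]]; rewrite ?mul0n ?mul1n ?mulSn; lia.
Qed.

(** For [k < N - n], the number [n + k] lies strictly between 0 and [N]. *)
Lemma root_mean_neg u (f : C -> C) (r : R) n N w : expands_as u f -> 0 < r < 1 ->
  N.-primitive_root w -> (0 < n <= N)%N ->
  modulus (root_mean f r w N n) <= abs_tail u r (N - n).
Proof.
move=> uf r01 hw /andP[n0 nN].
rewrite -[root_mean _ _ _ _ _]subr0.
suff -> : 0 = \sum_(0 <= k < N - n | (N %| n + k)%N) u k * ofR r ^+ k.
  exact: root_mean_le.
rewrite big_mkord big1// => i /dvdnP[q].
have := ltn_ord i; case: q => [|q]; rewrite ?mul0n ?mulSn; lia.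
Qed.

(** Both coefficients, multiplied by [r^n], lie within a vanishing tail of the same average; the
    radius 1/2 is an arbitrary choice in (0, 1). *)
Lemma expands_coef_unique u v (f g : C -> C) : expands_as u f -> expands_as v g ->
  (forall z, unit_disc z -> f z = g z) -> u = v.
Proof.
move=> uf vg fg; apply/funext => n; apply/eqP; rewrite -subr_eq0 -modulus_eq0.
rewrite eq_le modulus_ge0 andbT.
pose r : R := 2^-1.
have r01 : 0 < r < 1 by rewrite /r; lra.
have r01' : 0 <= r < 1 by rewrite /r; lra.
have rn0 : 0 < r ^+ n by rewrite exprn_gt0//; case/andP: r01.
rewrite -(ler_pM2r rn0) mul0r.
have : (fun N => abs_tail u r (N + n.+1)%N + abs_tail v r (N + n.+1)%N) @ \oo --> 0 + 0.
  by apply: cvgD; rewrite (cvg_shiftn n.+1); [exact: abs_tail_cvg0 uf _|exact: abs_tail_cvg0 vg _].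
rewrite addr0 => /ge_cvg; apply=> N.
have [|w hw] := @primitive_root_exists (N + n.+1); first by rewrite addnS.
have nN : (n < N + n.+1)%N by rewrite addnS ltnS leq_addl.
have hu := root_mean_coef uf r01 hw nN; have hv := root_mean_coef vg r01 hw nN.
have fgm : root_mean f r w (N + n.+1) (N + n.+1 - n) = root_mean g r w (N + n.+1) (N + n.+1 - n).
  congr (_ * _); apply: eq_bigr => j _; congr (_ * _); apply: fg.
  rewrite /unit_disc/= modulusM modulusX modulus_ofR.
  rewrite (modulus_unity_root _ (prim_expr_order hw)) ?addnS// expr1n mulr1.
  by rewrite gtr0_norm; case/andP: r01.
rewrite fgm in hu.
have -> : modulus (u n - v n) * r ^+ n = modulus (u n * ofR r ^+ n - v n * ofR r ^+ n).
  rewrite -mulrBl modulusM modulusX modulus_ofR gtr0_norm//; case/andP: r01 => //.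
apply: le_trans (lerD hu hv).
rewrite [X in _ <= X + _]modulus_distC.
by apply: le_trans (modulusD _ _); rewrite addrA subrK.
Qed.

(** * Caratheodory's bound for functions of positive real part *)

Lemma ReD z w : complex.Re (z + w) = complex.Re z + complex.Re w.
Proof. by case: z; case: w. Qed.
Lemma ReB z w : complex.Re (z - w) = complex.Re z - complex.Re w.
Proof. by case: z; case: w. Qed.
Lemma Re_sum I (s : seq I) (P : pred I) (F : I -> C) :
  complex.Re (\sum_(i <- s | P i) F i) = \sum_(i <- s | P i) complex.Re (F i).
Proof. exact: (big_morph _ ReD (erefl : complex.Re (0 : C) = 0)). Qed.
Lemma ReMr z (x : R) : complex.Re (ofR x * z) = x * complex.Re z.
Proof. by case: z => a b; rewrite /= mul0r subr0. Qed.
Lemma Re_le_modulus z : complex.Re z <= modulus z.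
Proof. exact: le_trans (ler_norm _) (modulus_Re _). Qed.

Lemma conj_unit z : modulus z = 1 -> z^*%C = z^-1.
Proof.
move=> z1; have z0 : z != 0 by rewrite -modulus_gt0 z1.
apply: (mulfI z0); rewrite mulfV// -[LHS]/(z * z^*%C : C) -sqr_normc.
by rewrite -[`|z|]/(`|z : C|) normCE z1 -ofRX expr1n.
Qed.

(** The conjugate of [h j = e w^(j (N - n))] is [e^-1 w^(j n)], so the combination is the average of
    [f (r w^j) (1 - Re (h j))], with non-negative weights because [h j] is unimodular. *)
Lemma Re_root_mean_ge0 (f : C -> C) (r : R) n N (w e : C) :
  (forall z, unit_disc z -> 0 < complex.Re (f z)) -> 0 < r < 1 ->
  N.-primitive_root w -> (n <= N)%N -> modulus e = 1 ->
  0 <= complex.Re (root_mean f r w N N - ofR 2^-1 * (e * root_mean f r w N (N - n)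
         + e^-1 * root_mean f r w N n)).
Proof.
move=> f0 /andP[r0 r1] hw nN e1.
have N0 := prim_order_gt0 hw; have wN := prim_expr_order hw.
have w1 := modulus_unity_root N0 wN.
have wu : w != 0 by rewrite -modulus_gt0 w1.
pose h (j : nat) : C := e * w ^+ (j * (N - n)).
have hj j : modulus (h j) = 1 by rewrite modulusM e1 modulusX w1 expr1n mul1r.
have hV j : (h j)^*%C = e^-1 * w ^+ (j * n).
  rewrite conj_unit// invfM; congr (_ * _).
  apply: (mulfI (expf_neq0 (j * (N - n)) wu)); rewrite mulfV ?expf_neq0//.
  by rewrite -exprD -mulnDr subnK// mulnC exprM wN expr1n.
rewrite /root_mean !(mulrCA _ N%:R^-1) -mulrDr (mulrCA _ N%:R^-1) -mulrBr.
rewrite !mulr_sumr -big_split/= mulr_sumr -sumrB.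
rewrite -ofR_nat -ofRV ReMr mulr_ge0// ?invr_ge0// Re_sum; apply: sumr_ge0 => j _.
have -> : w ^+ (j * N) = 1 by rewrite mulnC exprM wN expr1n.
set g := f _.
have -> : 1 * g - ofR 2^-1 * (e * (w ^+ (j * (N - n)) * g) + e^-1 * (w ^+ (j * n) * g))
  = ofR (1 - complex.Re (h j)) * g.
  transitivity ((1 - ofR 2^-1 * (h j + e^-1 * w ^+ (j * n))) * g).
    by rewrite /h; ring.
  have := addcJ (h j); rewrite hV => hh; congr (_ * _).
  rewrite [h j + _]hh -[(complex.Re (h j))%:C%C]/(ofR (complex.Re (h j))).
  by rewrite -[2 : C]ofR_nat mulrA -ofRM mulVf ?pnatr_eq0// mul1r ofRD ofRN.
rewrite ReMr mulr_ge0//.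
  by rewrite subr_ge0 (le_trans (Re_le_modulus _))// hj.
rewrite ltW// f0// /unit_disc/= modulusM modulusX w1 expr1n mulr1 modulus_ofR.
by rewrite gtr0_norm.
Qed.

Lemma psum0 u : psum u 0 = u 0%N.
Proof.
apply: (cvg_lim (@norm_hausdorff _ _)); rewrite -cvg_shiftS.
rewrite (_ : (fun n => _) = cst (u 0%N)); first exact: cvg_cst.
apply/funext => k; rewrite /series/= big_nat_recl//= expr0 mulr1.
by rewrite big1 ?addr0// => i _; rewrite exprS mul0r mulr0.
Qed.

(* The mean of [f (r w ^ j) (1 - Re (e w ^ (- j n)))] over the N-th roots of unity
   is non-negative and tends to [Re (u 0) - Re (e u n) r ^ n / 2]. *)
Lemma caratheodory_coef u (f : C -> C) n : expands_as u f ->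
  (forall z, unit_disc z -> 0 < complex.Re (f z)) -> (0 < n)%N ->
  modulus (u n) <= 2 * complex.Re (u 0%N).
Proof.
move=> uf f0 n0.
have [un0|un0] := eqVneq (u n) 0.
  have d0 : unit_disc (0 : C) by rewrite /unit_disc/= modulus0.
  rewrite un0 modulus0 mulr_ge0//; have := f0 _ d0.
  rewrite (expands_psum uf d0) => /ltW; congr (0 <= complex.Re _).
  exact: psum0.
have mun : 0 < modulus (u n) by rewrite modulus_gt0.
(* A unimodular factor with [e * u n = |u n|]: once the phase is removed, the real part sees the
   full modulus. *)
pose e : C := ofR (modulus (u n)) / u n.
have e1 : modulus e = 1.
  by rewrite modulusM modulusV modulus_ofR gtr0_norm// mulfV ?gt_eqF.
have key r : 0 < r < 1 -> modulus (u n) * r ^+ n <= 2 * complex.Re (u 0%N).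
  move=> r01; have r01' : 0 <= r < 1 by case/andP: r01 => /ltW -> ->.
  rewrite -subr_le0.
  (* One tail for the mean approximating [u 0], and half a tail for each of the means approximating
     [u n * r^n] and 0. *)
  have : (fun N => 2 * (abs_tail u r (N + n.+1)%N + 2^-1 * (abs_tail u r (N + n.+1)%N
      + abs_tail u r N.+1))) @ \oo --> 2 * ((0 : R) + 2^-1 * (0 + 0)).
    have t0 := abs_tail_cvg0 uf r01'.
    have t1 : (fun N => abs_tail u r (N + n.+1)%N) @ \oo --> 0 by rewrite (cvg_shiftn n.+1).
    have t2 : (fun N => abs_tail u r N.+1) @ \oo --> 0 by rewrite (cvg_shiftS (abs_tail u r)).
    apply: cvgM; first exact: cvg_cst.
    by apply: cvgD => //; apply: cvgM; [exact: cvg_cst|exact: cvgD].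
  rewrite addr0 mulr0 addr0 mulr0 => /ge_cvg; apply=> N.
  have [|w hw] := @primitive_root_exists (N + n.+1); first by rewrite addnS.
  have nN : (n < N + n.+1)%N by rewrite addnS ltnS leq_addl.
  have N0 : (0 < N + n.+1)%N by rewrite addnS.
  have h1 := root_mean_coef uf r01 hw N0; rewrite subn0 expr0 mulr1 in h1.
  have h2 := root_mean_coef uf r01 hw nN.
  have h3 : modulus (root_mean f r w (N + n.+1) n) <= abs_tail u r N.+1.
    have -> : N.+1 = (N + n.+1 - n)%N by rewrite addnS -addSn addnK.
    by apply: root_mean_neg => //; rewrite n0 ltnW.
  have := Re_root_mean_ge0 f0 r01 hw (ltnW nN) e1.
  set m1 := root_mean _ _ _ _ _ in h1 *; set m2 := root_mean _ _ _ _ _ in h2 *.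
  set m3 := root_mean _ _ _ _ _ in h3 *.
  rewrite ReB ReMr ReD.
  have l1 : complex.Re m1 - complex.Re (u 0%N) <= abs_tail u r (N + n.+1).
    by rewrite -ReB (le_trans (Re_le_modulus _)).
  have l2 : modulus (u n) * r ^+ n - complex.Re (e * m2) <= abs_tail u r (N + n.+1).
    have -> : modulus (u n) * r ^+ n = complex.Re (e * (u n * ofR r ^+ n)).
      by rewrite mulrA /e mulfVK// -ofRX -ofRM.
    rewrite -ReB -mulrBr (le_trans (Re_le_modulus _))// modulusM e1 mul1r.
    by rewrite modulus_distC.
  have l3 : - complex.Re (e^-1 * m3) <= abs_tail u r N.+1.
    have -> : - complex.Re (e^-1 * m3) = complex.Re (- (e^-1 * m3)).
      by case: (e^-1 * m3).
    rewrite (le_trans (Re_le_modulus _))// modulusN modulusM modulusV e1 invr1.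
    by rewrite mul1r.
  lra.
(* The radii [1 - 1 / (k + 2)] tend to 1; the shift of [harmonic] keeps the first one positive. *)
have : (fun k => modulus (u n) * (1 - harmonic k.+1) ^+ n) @ \oo -->
    modulus (u n) * (1 - 0) ^+ n.
  apply: cvgM; first exact: cvg_cst.
  have ch : (fun k : nat => 1 - harmonic k.+1) @ \oo --> (1 - 0 : R).
    apply: cvgB; first exact: cvg_cst.
    by have := @cvg_harmonic R; rewrite -cvg_shiftS.
  elim: {n0 un0 mun e e1 key} n => [|n IH]; first by under eq_fun do rewrite expr0; exact: cvg_cst.
  by under eq_fun do rewrite exprS; rewrite exprS; exact: cvgM.
rewrite subr0 expr1n mulr1 => /le_cvg; apply=> k; apply: key.
have k1 : k.+2%:R^-1 < 1 :> R by rewrite invf_lt1 ?ltr0n// ltr1n.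
have k0 : 0 < k.+2%:R^-1 :> R by rewrite invr_gt0 ltr0n.
by rewrite /harmonic/= subr_gt0 k1/= ltrBlDr ltrDl.
Qed.
End ComplexSeries.

(** * Rising factorials and the recentering identity *)

Section Pochhammer.

Lemma pochhammer0 (K : pzRingType) (x : K) : pochhammer x 0 = 1.
Proof. by rewrite /pochhammer big_ord0. Qed.

Lemma pochhammerSr (K : pzRingType) (x : K) n :
  pochhammer x n.+1 = pochhammer x n * (x + n%:R).
Proof. by rewrite /pochhammer big_ord_recr. Qed.

Lemma pochhammerS (K : pzRingType) (x : K) n :
  pochhammer x n.+1 = x * pochhammer (x + 1) n.
Proof.
rewrite /pochhammer big_ord_recl/= addr0; congr (_ * _); apply: eq_bigr => i _.
by rewrite /bump leq0n natrD addrA.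
Qed.

Lemma pochhammerD (K : pzRingType) (x : K) m n :
  pochhammer x (m + n) = pochhammer x m * pochhammer (x + m%:R) n.
Proof.
elim: n => [|n IH]; first by rewrite addn0 pochhammer0 mulr1.
by rewrite addnS !pochhammerSr IH -mulrA natrD addrA.
Qed.

Lemma pochhammer_gt0 (K : numDomainType) (x : K) n : 0 < x -> 0 < pochhammer x n.
Proof. by move=> x0; apply: prodr_gt0 => i _; rewrite ltr_pwDl. Qed.

Lemma pochhammer_ge0 (K : numDomainType) (x : K) n : 0 <= x -> 0 <= pochhammer x n.
Proof. by move=> x0; apply: prodr_ge0 => i _; rewrite addr_ge0. Qed.

Lemma pochhammer1 (K : pzRingType) n : pochhammer (1 : K) n = n`!%:R.
Proof.
elim: n => [|n IH]; first by rewrite pochhammer0.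
by rewrite pochhammerSr IH factS mulnC natrM nat1r.
Qed.

Lemma pochhammer_ofR (R : realType) (x : R) n :
  pochhammer (ofR x) n = ofR (pochhammer x n).
Proof.
by rewrite /pochhammer ofR_prod; apply: eq_bigr => i _; rewrite ofRD ofR_nat.
Qed.

Lemma modulus_pochhammer (R : realType) (z : CC R) n :
  modulus (pochhammer z n) <= pochhammer (modulus z) n.
Proof.
rewrite /pochhammer modulus_prod; apply: ler_prod => i _.
by rewrite modulus_ge0/= (le_trans (modulusD _ _))// modulus_nat.
Qed.

(** The weight [F] takes both [j] and [n - j], so that one splitting serves the two sides of the
    recentering identity. *)
Lemma sum_pascal (K : pzRingType) (F : nat -> nat -> K) n :
  \sum_(j < n.+2) 'C(n.+1, j)%:R * F j (n.+1 - j)%N =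
  \sum_(j < n.+1) 'C(n, j)%:R * F j (n - j).+1 +
  \sum_(j < n.+1) 'C(n, j)%:R * F j.+1 (n - j)%N.
Proof.
rewrite big_ord_recl/= bin0 subn0.
under eq_bigr do rewrite /bump leq0n add1n binS natrD mulrDl subSS.
rewrite big_split/= addrA; congr (_ + _).
rewrite [in RHS]big_ord_recl/= bin0 subn0; congr (_ + _).
rewrite big_ord_recr/= bin_small// mul0r addr0; apply: eq_bigr => i _.
by rewrite /bump leq0n add1n subnSK.
Qed.

(* Both sides are the integral of [(1 + t z)^n] against the beta density with
   parameters [q], [s]: on the right [1 + t z = (1 - t) + t (1 + z)]. *)
Lemma sum_pochhammer_recenter (K : fieldType) (q s z : K) n :
  (forall k, q + s + k%:R != 0) ->
  \sum_(k < n.+1) 'C(n, k)%:R * (pochhammer q k / pochhammer (q + s) k * z ^+ k) =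
  \sum_(j < n.+1) 'C(n, j)%:R *
    (pochhammer q j * pochhammer s (n - j) / pochhammer (q + s) n * (1 + z) ^+ j).
Proof.
elim: n q s => [|n IH] q s qs0.
  by rewrite !big_ord1 /= !pochhammer0 !expr0 !mulr1.
have r0 : q + s != 0 by have := qs0 0%N; rewrite addr0.
have qs1 k : (q + 1) + s + k%:R != 0.
  by have := qs0 k.+1; rewrite -nat1r; congr (_ != 0); ring.
have qs1' k : q + (s + 1) + k%:R != 0.
  by have := qs0 k.+1; rewrite -nat1r; congr (_ != 0); ring.
rewrite (sum_pascal (fun k _ => pochhammer q k / pochhammer (q + s) k * z ^+ k)).
rewrite (sum_pascal (fun j i => pochhammer q j * pochhammer s i /
  pochhammer (q + s) n.+1 * (1 + z) ^+ j)).
have e1 : q + s + 1 = q + 1 + s by ring.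
have e2 : q + (s + 1) = q + 1 + s by ring.
(* One factor of [(1 + t z)^(n + 1)] is split as [(1 - t) + t (1 + z)]: [1 - t] has mean
   [s / (q + s)] and raises [s] by 1, while [t] has mean [q / (q + s)] and raises [q] by 1. *)
transitivity (s / (q + s) * (\sum_(k < n.+1) 'C(n, k)%:R *
    (pochhammer q k / pochhammer (q + (s + 1)) k * z ^+ k)) +
  q / (q + s) * (1 + z) * (\sum_(k < n.+1) 'C(n, k)%:R *
    (pochhammer (q + 1) k / pochhammer (q + 1 + s) k * z ^+ k))); last first.
  rewrite (IH _ _ qs1) (IH _ _ qs1') !mulr_sumr; congr (_ + _); apply: eq_bigr => j _.
    rewrite [pochhammer s _.+1]pochhammerS [pochhammer (q + s) _]pochhammerS e1 e2.
    by rewrite invfM; ring.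
  rewrite [pochhammer q _.+1]pochhammerS [pochhammer (q + s) _]pochhammerS e1 exprS.
  by rewrite invfM; ring.
rewrite !mulr_sumr -!big_split/=; apply: eq_bigr => k _.
rewrite e2 pochhammerS (pochhammerS (q + s)) e1 exprS.
have h1 : q * pochhammer (q + 1) k = pochhammer q k * (q + k%:R).
  by rewrite -pochhammerS pochhammerSr.
have h2 : (q + s) * pochhammer (q + 1 + s) k = pochhammer (q + s) k * (q + s + k%:R).
  by rewrite -e1 -pochhammerS pochhammerSr.
have pk0 : pochhammer (q + s) k != 0 by apply/prodf_neq0 => i _.
have pk1 : pochhammer (q + 1 + s) k != 0 by apply/prodf_neq0 => i _.
have key : pochhammer q k / pochhammer (q + s) k = (s * pochhammer q k +
    q * pochhammer (q + 1) k) / ((q + s) * pochhammer (q + 1 + s) k).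
  by rewrite h1 h2; field; rewrite pk0 qs0.
by rewrite key; field; rewrite r0 pk1.
Qed.

End Pochhammer.

Lemma cvg_seriesMl (R : numFieldType) (f : nat -> R) (k l : R) :
  series f @ \oo --> l -> series (fun n => k * f n) @ \oo --> k * l.
Proof.
move=> fl; have -> : series (fun n => k * f n) = (fun N => k * series f N).
  by apply/funext => N; rewrite /series/= mulr_sumr.
by apply: cvgM fl; exact: cvg_cst.
Qed.

(** * Integrals over the open half-line and scaling of the Gamma integrand *)

Section GammaIntegral.
Variable R : realType.
Local Notation mu := (@lebesgue_measure R).
Local Notation D := (`]0%R, +oo[%classic : set R).
Implicit Types (z k x y : R).

Lemma measurable_halfline : measurable D.
Proof. exact: measurable_itv. Qed.
Hint Resolve measurable_halfline : core.

(** The substitution [s -> k s] is carried out on closed rays, which exhaust the open half-line; the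
    factor [k] makes the rays on the two sides correspond. *)
Lemma cvg_integral_halfline (f : R -> R) (k : R) : 0 < k ->
  measurable_fun setT f -> (forall x, 0 <= f x) ->
  (\int[mu]_(x in `[(k * n.+1%:R^-1)%R, +oo[) (f x)%:E)%E @[n --> \oo]
    --> (\int[mu]_(x in D) (f x)%:E)%E.
Proof.
move=> k0 mf f0.
have -> : D = \bigcup_n `[k * n.+1%:R^-1, +oo[%classic.
  apply/seteqP; split => x /=; rewrite in_itv/= andbT.
    move=> x0; exists (Num.truncn (k / x)) => //=; rewrite in_itv/= andbT.
    by rewrite ler_pdivrMr// mulrC -ler_pdivrMr// ltW// truncnS_gt.
  by move=> [n _] /=; rewrite in_itv/= andbT; apply: lt_le_trans; rewrite divr_gt0.
apply: ge0_nondecreasing_set_cvg_integral.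
- move=> m n mn; apply/subsetPset => x /=; rewrite !in_itv/= !andbT.
  apply: le_trans; apply: ler_wpM2l; first exact: ltW.
  by rewrite lef_pV2 ?posrE ?ltr0n// ler_nat.
- by move=> n; exact: measurable_itv.
- by move=> n; apply/measurable_EFinP; exact: measurable_funTS.
- by move=> n x _; rewrite lee_fin.
Qed.

(** The rate [k] is kept general: it is the second variable in the Tonelli arguments and becomes
    [1 - x] in the binomial series. *)
Definition gamma_integrand (z k s : R) : R := s `^ (z - 1) * expR (- (k * s)).

Lemma gamma_integrand_ge0 z k s : 0 <= gamma_integrand z k s.
Proof. by rewrite mulr_ge0 ?powR_ge0 ?expR_ge0. Qed.

Lemma measurable_gamma_integrand z k : measurable_fun setT (gamma_integrand z k).
Proof.
apply: measurable_funM; first exact: measurable_powR.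
apply: measurableT_comp; first exact: measurable_expR.
apply: measurableT_comp => //; exact: mulrl_measurable.
Qed.

Lemma is_derive_continuous (f : R -> R) (x l : R) :
  is_derive x (1 : R) f l -> {for x, continuous f}.
Proof. by move=> [h _]; apply: differentiable_continuous; apply/derivable1_diffP. Qed.

Lemma continuous_powR (a x : R) : 0 < x -> {for x, continuous (fun x : R => x `^ a)}.
Proof.
by move=> x0; exact: is_derive_continuous (is_derive1_powR a x0).
Qed.

Lemma continuous_gamma_integrand z k x : 0 < x -> {for x, continuous (gamma_integrand z k)}.
Proof.
move=> x0; apply: continuousM; first exact: continuous_powR.
apply: continuous_comp; last exact: continuous_expR.
by apply: continuousN; apply: mulrl_continuous.
Qed.

Lemma gamma_integrand_scale z k s : 0 < k -> 0 < s ->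
  gamma_integrand z 1 (k * s) * k = k `^ z * gamma_integrand z k s.
Proof.
move=> k0 s0; rewrite /gamma_integrand mul1r powRM ?(ltW k0) ?(ltW s0)//.
have -> : k `^ z = k `^ (z - 1) * k.
  by rewrite -{3}[k]powRr1 ?(ltW k0)// -powRD ?subrK// (gt_eqF k0) implybT.
ring.
Qed.

Lemma integral_gamma_scale_itv z k (a : R) : 0 < k -> 0 < a ->
  (\int[mu]_(s in `[(k * a)%R, +oo[) (gamma_integrand z 1 s)%:E =
   \int[mu]_(s in `[a, +oo[) (k `^ z * gamma_integrand z k s)%:E)%E.
Proof.
move=> k0 a0.
have dF (x : R) : is_derive x (1 : R) (fun s => k * s) k.
  by apply: is_derive_eq; rewrite -[_ *: _]/(_ * _) mulr1.
have dF1 : derive1 (fun s => k * s) = cst k.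
  by apply/funext => x; rewrite derive1E derive_val.
rewrite (@increasing_ge0_integration_by_substitutiony R (fun s => k * s) (gamma_integrand z 1) a).
- apply: eq_integral => s; rewrite inE/= in_itv/= andbT => sa.
  rewrite dF1 -[LHS]/((gamma_integrand z 1 (k * s) * k)%:E).
  by rewrite gamma_integrand_scale// (lt_le_trans a0).
- by move=> x y _ _; rewrite ltr_pM2l.
- by rewrite dF1 => x _; exact: cvg_cst.
- by rewrite dF1; exact: is_cvg_cst.
- by rewrite dF1; exact: is_cvg_cst.
- split; first by move=> x _; exact: (@ex_derive _ _ _ _ _ _ _ (dF x)).
  by apply: cvg_at_right_filter; apply: mulrl_continuous.
- by apply: gt0_cvgMry => //; exact: cvg_id.
- apply: continuous_in_subspaceT => x; rewrite inE/= in_itv/= andbT => kx.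
  by apply: continuous_gamma_integrand; rewrite (lt_le_trans _ kx)// mulr_gt0.
- by move=> x _; exact: gamma_integrand_ge0.
Qed.

Lemma integral_gamma_scale z k : 0 < k ->
  (\int[mu]_(s in D) (gamma_integrand z k s)%:E =
   (k `^ (- z))%:E * \int[mu]_(s in D) (gamma_integrand z 1 s)%:E)%E.
Proof.
move=> k0.
have kz : 0 < k `^ z by rewrite powR_gt0.
have -> : (\int[mu]_(s in D) (gamma_integrand z 1 s)%:E =
    \int[mu]_(s in D) (k `^ z * gamma_integrand z k s)%:E)%E.
  have h1 := cvg_integral_halfline k0 (measurable_gamma_integrand z 1) (gamma_integrand_ge0 z 1).
  have m2 : measurable_fun setT (fun s => k `^ z * gamma_integrand z k s).
    by apply: measurable_funM => //; exact: measurable_gamma_integrand.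
  have h2 := cvg_integral_halfline ltr01 m2
    (fun s => mulr_ge0 (ltW kz) (gamma_integrand_ge0 z k s)).
  apply: (cvg_unique (@ereal_hausdorff _) h1).
  have -> : (fun n => \int[mu]_(x in `[(k / n.+1%:R)%R, +oo[) (gamma_integrand z 1 x)%:E)%E =
    (fun n => \int[mu]_(x in `[(1 / n.+1%:R)%R, +oo[) (k `^ z * gamma_integrand z k x)%:E)%E.
    apply/funext => n; rewrite div1r; apply: integral_gamma_scale_itv => //.
  exact: h2.
under [in RHS]eq_integral do rewrite EFinM.
rewrite ge0_integralZl_EFin ?(ltW kz)//; last 2 first.
- by move=> x _; rewrite lee_fin gamma_integrand_ge0.
- by apply/measurable_EFinP; apply: measurable_funTS; exact: measurable_gamma_integrand.
by rewrite muleA -EFinM powRN mulVf ?gt_eqF// mul1e.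
Qed.

Lemma cvgr_powRN z : 0 < z -> (x `^ (- z)) @[x --> +oo] --> (0 : R).
Proof.
move=> z0; apply/cvgrPdist_lt => e e0; near=> x.
have x0 : 0 < x by near: x; exact: nbhs_pinfty_gt.
rewrite sub0r normrN ger0_norm ?powR_ge0// powRN invf_plt ?posrE ?powR_gt0//.
have h : (e^-1) `^ (z^-1) < x by near: x; exact: nbhs_pinfty_gt.
have := gt0_ltr_powR z0 (powR_ge0 _ _) (ltW x0) h.
by rewrite -powRrM mulVf ?gt_eqF// powRr1// invr_ge0 ltW.
Unshelve. all: by end_near. Qed.

Lemma integral_powRN z : 0 < z ->
  (\int[mu]_(k in `[1%R, +oo[) (k `^ (- (z + 1)))%:E = (z^-1)%:E)%E.
Proof.
move=> z0.
have d (x : R) : 0 < x -> is_derive x (1 : R) (fun k => - z^-1 * k `^ (- z)) (x `^ (- (z + 1))).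
  move=> x0; have h := is_derive1_powR (- z) x0.
  apply: is_derive_eq; rewrite opprD -[X in _ *: X]/(_ * _).
  by rewrite /GRing.scale/= mulrA mulrNN mulVf ?mul1r ?gt_eqF.
rewrite (@ge0_continuous_FTC2y _ _ (fun k => - z^-1 * k `^ (- z)) 1 0).
- by rewrite powR1 mulr1 sub0e EFinN oppeK.
- by move=> x _; exact: powR_ge0.
- apply: continuous_in_subspaceT => x; rewrite inE/= in_itv/= andbT => x1.
  by apply: continuous_powR; rewrite (lt_le_trans ltr01).
- by rewrite -(mulr0 (- z^-1)); apply: cvgM; [exact: cvg_cst|exact: cvgr_powRN].
- by move=> x x1; exact: (@ex_derive _ _ _ _ _ _ _ (d x (lt_trans ltr01 x1))).
- by apply: cvg_at_right_filter; exact: (is_derive_continuous (d 1 ltr01)).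
- move=> x; rewrite in_itv/= andbT => x1; rewrite derive1E.
  exact: (@derive_val _ _ _ _ _ _ _ (d x (lt_trans ltr01 x1))).
Qed.

Lemma integral_expRN (s : R) : 0 < s -> forall a : R,
  (\int[mu]_(k in `[a, +oo[) (s * expR (- (k * s)))%:E = (expR (- (a * s)))%:E)%E.
Proof.
move=> s0 a.
have d (x : R) : is_derive x (1 : R) (fun k => - expR (- (k * s))) (s * expR (- (x * s))).
  apply: is_derive_eq.
  by rewrite -![_ *: _]/(_ * _); ring.
rewrite (@ge0_continuous_FTC2y _ _ (fun k => - expR (- (k * s))) a 0).
- by rewrite sub0e EFinN oppeK.
- by move=> x _; rewrite mulr_ge0 ?expR_ge0 ?ltW.
- apply: continuous_subspaceT => x.
  have c : {for x, continuous (fun k => s * expR (- (k * s)))}.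
    apply: continuousM; first exact: cvg_cst.
    apply: continuous_comp; last exact: continuous_expR.
    by apply: continuousN; apply: mulrr_continuous.
  exact: c.
- rewrite -oppr0; apply: cvgN.
  have h : (fun k : R => k * s) @ +oo --> +oo by apply: gt0_cvgMly => //; exact: cvg_id.
  exact: (cvg_comp (fun k : R => k * s) (fun x => expR (- x)) h (@cvgr_expR R)).
- by move=> x _; exact: (@ex_derive _ _ _ _ _ _ _ (d x)).
- by apply: cvg_at_right_filter; exact: (is_derive_continuous (d a)).
- by move=> x _; rewrite derive1E; exact: (@derive_val _ _ _ _ _ _ _ (d x)).
Qed.

Lemma fubini_tonelli_in (D1 D2 : set R) (h : R -> R -> R) :
  measurable D1 -> measurable D2 -> measurable_fun setT (fun p : R * R => h p.1 p.2) ->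
  (forall x y, 0 <= h x y) ->
  (\int[mu]_(x in D1) \int[mu]_(y in D2) (h x y)%:E =
   \int[mu]_(y in D2) \int[mu]_(x in D1) (h x y)%:E)%E.
Proof.
move=> mD1 mD2 mh h0.
pose f (p : R * R) : \bar R := (h p.1 p.2 * \1_D1 p.1 * \1_D2 p.2)%:E.
have := @fubini_tonelli _ _ _ _ _ mu mu f.
have E1 : (\int[mu]_x \int[mu]_y f (x, y) = \int[mu]_(x in D1) \int[mu]_(y in D2) (h x y)%:E)%E.
  rewrite [RHS]integral_mkcond; apply: eq_integral => x _; rewrite patchE.
  case: ifPn => xD.
    rewrite [RHS]integral_mkcond; apply: eq_integral => y _.
    by rewrite patchE /f/= !indicE xD mulr1; case: ifP => _; rewrite ?mulr1 ?mulr0.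
  by rewrite integral0_eq// => y _; rewrite /f/= indicE (negbTE xD) mulr0 mul0r.
have E2 : (\int[mu]_y \int[mu]_x f (x, y) = \int[mu]_(y in D2) \int[mu]_(x in D1) (h x y)%:E)%E.
  rewrite [RHS]integral_mkcond; apply: eq_integral => y _; rewrite patchE.
  case: ifPn => yD.
    rewrite [RHS]integral_mkcond; apply: eq_integral => x _.
    by rewrite patchE /f/= !indicE yD mulr1; case: ifP => _; rewrite ?mulr1 ?mulr0.
  by rewrite integral0_eq// => x _; rewrite /f/= !indicE (negbTE yD) mulr0.
rewrite E1 E2; apply.
- apply/measurable_EFinP; apply: measurable_funM; first apply: measurable_funM => //.
    exact: measurableT_comp measurable_fst.
  exact: measurableT_comp measurable_snd.
- by move=> p; rewrite lee_fin !mulr_ge0.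
Qed.

End GammaIntegral.

(** * Functional equation, finiteness and positivity of Gamma *)

Section GammaFunction.
Variable R : realType.
Local Notation mu := (@lebesgue_measure R).
Local Notation D := (`]0%R, +oo[%classic : set R).
Implicit Types (z k x y : R).
Hint Resolve measurable_halfline : core.

(** [Gamma] takes the finite part of this integral, which would be 0 at an infinite value. The
    functional equation is therefore proved in the extended reals, and finiteness is deduced from
    it. *)
Let eGamma z : \bar R := (\int[mu]_(s in D) (gamma_integrand z 1 s)%:E)%E.

Let measurable_gi z k (A : set R) : measurable_fun A (fun s => (gamma_integrand z k s)%:E).
Proof.
by apply/measurable_EFinP; apply: measurable_funTS; exact: measurable_gamma_integrand.
Qed.

Let eGamma_ge0 z : (0 <= eGamma z)%E.
Proof. by apply: integral_ge0 => x _; rewrite lee_fin gamma_integrand_ge0. Qed.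

(* Tonelli for [s ^ z * exp (- k s)] over [s > 0], [k >= 1]. *)
Let eGammaS z : 0 < z -> eGamma z = ((z^-1)%:E * eGamma (z + 1))%E.
Proof.
move=> z0.
have := @fubini_tonelli_in R D `[1, +oo[%classic (fun s k => gamma_integrand (z + 1) k s).
have E1 : (\int[mu]_(x in D) \int[mu]_(y in `[1%R, +oo[) (gamma_integrand (z + 1) y x)%:E =
    eGamma z)%E.
  apply: eq_integral => s; rewrite inE/= in_itv/= andbT => s0.
  have -> : (gamma_integrand z 1 s)%:E = ((s `^ (z - 1))%:E * (expR (- (1 * s)))%:E)%E.
    by rewrite -EFinM.
  rewrite -(integral_expRN s0 1) -ge0_integralZl_EFin ?powR_ge0//.
  - apply: eq_integral => k _; rewrite -EFinM; congr EFin.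
    rewrite /gamma_integrand addrK mulrA; congr (_ * _).
    by rewrite mulrC mulr_powRB1// ltW.
  - by move=> k _; rewrite lee_fin mulr_ge0 ?expR_ge0// ltW.
  - apply/measurable_EFinP; apply: measurable_funM => //.
    apply: measurableT_comp; first exact: measurable_expR.
    apply: measurableT_comp => //; exact: mulrr_measurable.
have E2 : (\int[mu]_(y in `[1%R, +oo[) \int[mu]_(x in D) (gamma_integrand (z + 1) y x)%:E =
    (z^-1)%:E * eGamma (z + 1))%E.
  rewrite -(integral_powRN z0) -ge0_integralZr//.
  - apply: eq_integral => k; rewrite inE/= in_itv/= andbT => k1.
    by rewrite integral_gamma_scale// (lt_le_trans ltr01).
  - by apply/measurable_EFinP; apply: measurable_funTS; exact: measurable_powR.
  - by move=> x _; rewrite lee_fin powR_ge0.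
rewrite E1 E2; apply => //.
- apply: measurable_funM.
    by apply: (measurableT_comp (measurable_powR _)); exact: measurable_fst.
  apply: measurableT_comp; first exact: measurable_expR.
  by apply: measurableT_comp => //; apply: measurable_funM; [exact: measurable_snd|exact: measurable_fst].
- by move=> s k; exact: gamma_integrand_ge0.
Qed.

Let eGamma1 : eGamma 1 = 1%E.
Proof.
rewrite /eGamma integral_itv_obnd_cbnd; last exact: measurable_gi.
have := @integral_expRN R 1 ltr01 0; rewrite mul0r oppr0 expR0 => <-.
apply: eq_integral => s _; congr EFin.
by rewrite /gamma_integrand subrr powRr0 mulrC mulrC mulr1 mul1r.
Qed.

(** The functional equation read backwards: a positive multiple of the next value is finite, hence
    so is that value. *)
Let eGamma_nat n : (eGamma n.+1%:R < +oo)%E.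
Proof.
elim: n => [|n IH]; first by rewrite eGamma1 ltry.
have n0 : 0 < n.+1%:R :> R by rewrite ltr0n.
move: IH; rewrite (eGammaS n0) natr1.
case: (eGamma n.+2%:R) (eGamma_ge0 n.+2%:R) => [r| |]//= _; first by move=> _; rewrite ltry.
by rewrite gt0_muley ?ltxx// lte_fin invr_gt0.
Qed.

(** With [n] the integer part of [z], [s^(z - 1) <= 1 + s^n] for [s > 0], which compares with two
    integer arguments. *)
Let eGamma_ge1 z : 1 <= z -> (eGamma z < +oo)%E.
Proof.
move=> z1; pose n := Num.truncn z.
have hz : z - 1 <= n%:R by rewrite lerBlDr natr1 ltW// truncnS_gt.
have le : (eGamma z <= eGamma 1 + eGamma n.+1%:R)%E.
  have g0 a (s : R) : D s -> (0 <= (gamma_integrand a 1 s)%:E)%E.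
    by move=> _; rewrite lee_fin gamma_integrand_ge0.
  have -> : (eGamma 1 + eGamma n.+1%:R =
      \int[mu]_(s in D) ((gamma_integrand 1 1 s)%:E + (gamma_integrand n.+1%:R 1 s)%:E))%E.
    by rewrite ge0_integralD//; first [exact: g0|exact: measurable_gi].
  apply: ge0_le_integral => //.
  - by move=> s _; rewrite lee_fin gamma_integrand_ge0.
  - exact: measurable_gi.
  - by apply: emeasurable_funD; exact: measurable_gi.
  - move=> s; rewrite /= in_itv/= andbT => s0; rewrite -EFinD lee_fin -mulrDl.
    apply: ler_wpM2r; first exact: expR_ge0.
    rewrite subrr powRr0 -natr1 addrK powR_mulrn ?(ltW s0)//.
    have [s1|s1] := leP s 1.
      rewrite (le_trans (_ : _ <= 1))//; last by rewrite lerDl exprn_ge0// ltW.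
      have h1 : 1 `^ (z - 1) = 1 :> R by rewrite powR1.
      rewrite -[leRHS]h1; apply: ge0_ler_powR; rewrite ?nnegrE ?subr_ge0//; exact: ltW.
    rewrite -[leLHS]add0r; apply: lerD => //.
    by rewrite -powR_mulrn ?(ltW s0)//; apply: ler_powR => //; exact: ltW.
by apply: le_lt_trans le _; rewrite eGamma1 lte_add_pinfty ?ltry.
Qed.

Let eGamma_lty z : 0 < z -> (eGamma z < +oo)%E.
Proof.
move=> z0; rewrite (eGammaS z0).
have : (eGamma (z + 1) < +oo)%E by apply: eGamma_ge1; rewrite lerDr ltW.
by case: (eGamma (z + 1)) (eGamma_ge0 (z + 1)) => [r| |]//= _ _; rewrite ltry.
Qed.

Lemma GammaE z : 0 < z -> eGamma z = (Gamma z)%:E.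
Proof.
move=> z0; rewrite /Gamma /Rintegral fineK.
  by apply: eq_integral => s _; rewrite /gamma_integrand mul1r.
rewrite (_ : (\int[_]_(x in _) _)%E = eGamma z).
  by rewrite ge0_fin_numE ?eGamma_lty ?eGamma_ge0.
by apply: eq_integral => s _; rewrite /gamma_integrand mul1r.
Qed.

Lemma GammaS z : 0 < z -> Gamma (z + 1) = z * Gamma z.
Proof.
move=> z0; have z1 : 0 < z + 1 by rewrite addr_gt0.
apply: EFin_inj; rewrite EFinM -!GammaE// (eGammaS z0) muleA -EFinM mulfV ?gt_eqF//.
by rewrite mul1e.
Qed.

Lemma Gamma_pochhammer z n : 0 < z -> Gamma (z + n%:R) = pochhammer z n * Gamma z.
Proof.
move=> z0; elim: n => [|n IH]; first by rewrite addr0 pochhammer0 mul1r.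
have zn : 0 < z + n%:R by rewrite ltr_pwDl.
by rewrite -natr1 addrA (GammaS zn) IH pochhammerSr mulrCA mulrA.
Qed.

Lemma integral_gamma_integrand z k : 0 < z -> 0 < k ->
  (\int[mu]_(s in D) (gamma_integrand z k s)%:E = (k `^ (- z) * Gamma z)%:E)%E.
Proof. by move=> z0 k0; rewrite integral_gamma_scale// -/(eGamma z) GammaE. Qed.

(** The functional equation reduces to [y >= 1], where the integrand is at least [exp (- 2)] on
    [1, 2]. *)
Lemma Gamma_gt0 z : 0 < z -> 0 < Gamma z.
Proof.
move=> z0.
suff h y : 1 <= y -> 0 < Gamma y.
  have : 0 < Gamma (z + 1) by apply: h; rewrite lerDr ltW.
  by rewrite GammaS// pmulr_rgt0.
move=> y1; have y0 : 0 < y by exact: lt_le_trans y1.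
rewrite -lte_fin -(GammaE y0).
apply: (@lt_le_trans _ _ (\int[mu]_(s in `[1%R, 2%R]) (cst (expR (- 2))%:E s))%E).
  rewrite integral_cst//= lebesgue_measure_itv/= lte_fin ltr1n/=.
  by rewrite -EFinD -EFinM lte_fin mulr_gt0 ?expR_gt0//; lra.
apply: (@le_trans _ _ (\int[mu]_(s in `[1%R, 2%R]) (gamma_integrand y 1 s)%:E)%E).
  apply: ge0_le_integral => //.
  - by move=> s _; rewrite lee_fin expR_ge0.
  - exact: measurable_gi.
  - move=> s; rewrite /= in_itv/= => /andP[s1 s2]; rewrite lee_fin /gamma_integrand (mul1r s) -[leLHS]mul1r.
    apply: ler_pM; rewrite ?expR_ge0//; last by rewrite ler_expR lerN2.
    by rewrite -[leLHS](powRr0 s); apply: ler_powR => //; rewrite subr_ge0.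
apply: ge0_subset_integral => //.
- exact: measurable_gi.
- by move=> s _; rewrite lee_fin gamma_integrand_ge0.
- by move=> s; rewrite /= !in_itv/= andbT => /andP[s1 _]; exact: lt_le_trans s1.
Qed.

End GammaFunction.

(** * The beta integral on the half-line *)

Section BetaIntegral.
Variable R : realType.
Local Notation mu := (@lebesgue_measure R).
Local Notation D := (`]0%R, +oo[%classic : set R).
Implicit Types (x y w s t : R).
Hint Resolve measurable_halfline : core.

(** The density [t^(x - 1) (1 - t)^(y - 1) dt] after [t = 1 / (1 + w)]. Raising [x] by 1 multiplies
    it by [t], and raising [y] by 1 multiplies it by [1 - t = w / (1 + w)]. *)
Definition beta_integrand (x y w : R) : R := w `^ (y - 1) * (1 + w) `^ (- (x + y)).

Lemma beta_integrand_ge0 x y w : 0 <= beta_integrand x y w.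
Proof. by rewrite mulr_ge0 ?powR_ge0. Qed.

Lemma measurable_1Dpow (a : R) : measurable_fun setT (fun w : R => (1 + w) `^ a).
Proof. by apply: (measurableT_comp (measurable_powR _)); exact: measurable_funD. Qed.

Lemma measurable_beta_integrand x y : measurable_fun setT (beta_integrand x y).
Proof. apply: measurable_funM; [exact: measurable_powR|exact: measurable_1Dpow]. Qed.

Definition Beta x y : R := Gamma x * Gamma y / Gamma (x + y).

(* Tonelli for [s ^ (x + y - 1) * w ^ (y - 1) * exp (- s (1 + w))]. *)
Lemma integral_beta_integrand x y : 0 < x -> 0 < y ->
  (\int[mu]_(w in D) (beta_integrand x y w)%:E = (Beta x y)%:E)%E.
Proof.
move=> x0 y0; have xy0 : 0 < x + y by exact: addr_gt0.
pose h (s w : R) : R := w `^ (y - 1) * gamma_integrand (x + y) (1 + w) s.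
have := @fubini_tonelli_in R D D h.
have E1 : (\int[mu]_(s in D) \int[mu]_(w in D) (h s w)%:E = (Gamma x * Gamma y)%:E)%E.
  transitivity (\int[mu]_(s in D) ((gamma_integrand x 1 s)%:E * (Gamma y)%:E))%E.
    apply: eq_integral => s; rewrite inE/= in_itv/= andbT => s0.
    transitivity (\int[mu]_(w in D)
       ((s `^ (x + y - 1) * expR (- s))%:E * (gamma_integrand y s w)%:E))%E.
      apply: eq_integral => w _; rewrite -EFinM; congr EFin.
      rewrite /h /gamma_integrand mulrDl mul1r opprD expRD (mulrC w s); ring.
    rewrite ge0_integralZl_EFin ?mulr_ge0 ?powR_ge0 ?expR_ge0//; last 2 first.
    - by move=> w _; rewrite lee_fin gamma_integrand_ge0.
    - by apply/measurable_EFinP; apply: measurable_funTS; exact: measurable_gamma_integrand.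
    rewrite integral_gamma_integrand// -!EFinM; congr EFin.
    have -> : gamma_integrand x 1 s = s `^ (x + y - 1) * s `^ (- y) * expR (- s).
      rewrite -powRD; last by rewrite (gt_eqF s0) implybT.
      by rewrite /gamma_integrand mul1r; congr (_ `^ _ * _); ring.
    ring.
  rewrite ge0_integralZr//; last 3 first.
  - by apply/measurable_EFinP; apply: measurable_funTS; exact: measurable_gamma_integrand.
  - by move=> w _; rewrite lee_fin gamma_integrand_ge0.
  - by rewrite lee_fin ltW// Gamma_gt0.
  by rewrite integral_gamma_integrand// powR1 mul1r -EFinM.
have E2 : (\int[mu]_(w in D) \int[mu]_(s in D) (h s w)%:E =
    (Gamma (x + y))%:E * \int[mu]_(w in D) (beta_integrand x y w)%:E)%E.
  rewrite -ge0_integralZl_EFin//; last 3 first.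
  - by move=> w _; rewrite lee_fin beta_integrand_ge0.
  - by apply/measurable_EFinP; apply: measurable_funTS; exact: measurable_beta_integrand.
  - by rewrite ltW// Gamma_gt0.
  apply: eq_integral => w; rewrite inE/= in_itv/= andbT => w0.
  under eq_integral do rewrite /h EFinM.
  rewrite ge0_integralZl_EFin ?powR_ge0//; last 2 first.
  - by move=> s _; rewrite lee_fin gamma_integrand_ge0.
  - by apply/measurable_EFinP; apply: measurable_funTS; exact: measurable_gamma_integrand.
  rewrite integral_gamma_integrand ?addr_gt0// -!EFinM; congr EFin.
  rewrite /beta_integrand; ring.
rewrite E1 E2 => E; have {}E : (Gamma x * Gamma y)%:E =
   ((Gamma (x + y))%:E * \int[mu]_(w in D) (beta_integrand x y w)%:E)%E.
  apply: E => //.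
  - apply: measurable_funM.
      by apply: (measurableT_comp (measurable_powR _)); exact: measurable_snd.
    apply: measurable_funM.
      by apply: (measurableT_comp (measurable_powR _)); exact: measurable_fst.
    apply: (measurableT_comp (@measurable_expR R)); apply: measurableT_comp => //.
    apply: measurable_funM; last exact: measurable_fst.
    by apply: measurable_funD => //; exact: measurable_snd.
  - by move=> s w; rewrite mulr_ge0 ?powR_ge0// gamma_integrand_ge0.
have G0 := Gamma_gt0 xy0.
by rewrite /Beta mulrC EFinM E muleA -EFinM mulVf ?gt_eqF// mul1e.
Qed.

Lemma BetaDr x y n : 0 < x -> 0 < y ->
  Beta x (y + n%:R) = Beta x y * (pochhammer y n / pochhammer (x + y) n).
Proof.
move=> x0 y0; have xy0 : 0 < x + y by exact: addr_gt0.
rewrite /Beta addrA !Gamma_pochhammer//.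
have G0 : Gamma (x + y) != 0 by rewrite gt_eqF// Gamma_gt0.
have p0 : pochhammer (x + y) n != 0 by rewrite gt_eqF// pochhammer_gt0.
have alg (a b c p P : R) : c != 0 -> P != 0 -> a * (p * b) / (P * c) = a * b / c * (p / P).
  by move=> c0 P0; field; rewrite c0 P0.
exact: alg.
Qed.

Lemma beta_integrandDl x y w n : 0 < w ->
  beta_integrand (x + n%:R) y w = (1 + w)^-1 ^+ n * beta_integrand x y w.
Proof.
move=> w0; have w1 : 0 < 1 + w by rewrite addr_gt0.
rewrite /beta_integrand mulrCA; congr (_ * _).
have -> : - (x + n%:R + y) = - n%:R + - (x + y) by ring.
rewrite powRD; last by rewrite (gt_eqF w1) implybT.
by rewrite powR_invn ?(ltW w1)// exprVn.
Qed.

Lemma beta_integrandDr x y w (a : R) : 0 < w ->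
  beta_integrand x (y + a) w = (w / (1 + w)) `^ a * beta_integrand x y w.
Proof.
move=> w0; have w1 : 0 < 1 + w by rewrite addr_gt0.
rewrite /beta_integrand.
have -> : y + a - 1 = a + (y - 1) by ring.
have -> : - (x + (y + a)) = - a + - (x + y) by ring.
rewrite !powRD ?(gt_eqF w1) ?(gt_eqF w0) ?implybT//.
rewrite powRM ?invr_ge0 ?(ltW w0) ?(ltW w1)//.
have -> : (1 + w) `^ (- a) = (1 + w)^-1 `^ a.
  by rewrite -powR_inv1 ?(ltW w1)// -powRrM mulN1r.
ring.
Qed.

Lemma eseries_EFin (a : nat -> R) (l : R) : series a @ \oo --> l ->
  (\sum_(0 <= n <oo) (a n)%:E = l%:E)%E.
Proof.
move=> al; apply: cvg_lim => //.
rewrite (_ : (fun n => _) = EFin \o series a).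
  by apply: cvg_EFin; [exact: nearW|exact: al].
by apply/funext => n; rewrite /series/= sumEFin.
Qed.

Lemma eseries_EFin_cvg (a : nat -> R) (l : R) : (forall n, 0 <= a n) ->
  (\sum_(0 <= n <oo) (a n)%:E = l%:E)%E -> series a @ \oo --> l.
Proof.
move=> a0 al.
have ac : (fun n => (\sum_(0 <= k < n) (a k)%:E)%E) @ \oo --> l%:E.
  by rewrite -al; apply: is_cvg_nneseries => n _ _; rewrite lee_fin.
have -> : series a = fine \o (fun n => (\sum_(0 <= k < n) (a k)%:E)%E).
  by apply/funext => n /=; rewrite sumEFin.
exact: fine_cvg.
Qed.

Lemma integral_series_halfline (f : nat -> R -> R) (F : R -> R) (I : nat -> R) (S : R) :
  (forall n, measurable_fun setT (f n)) -> (forall n w, 0 < w -> 0 <= f n w) ->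
  (forall w, 0 < w -> series (f^~ w) @ \oo --> F w) ->
  (forall n, (\int[mu]_(w in D) (f n w)%:E = (I n)%:E)%E) ->
  series I @ \oo --> S -> (\int[mu]_(w in D) (F w)%:E = S%:E)%E.
Proof.
move=> mf f0 fF fI IS.
have f0' n w : D w -> (0 <= (f n w)%:E)%E.
  by rewrite /= in_itv/= andbT lee_fin => /f0.
transitivity (\int[mu]_(w in D) \sum_(0 <= n <oo) (f n w)%:E)%E.
  apply: eq_integral => w; rewrite inE/= in_itv/= andbT => w0; apply/esym.
  exact: eseries_EFin (fF _ w0).
rewrite integral_nneseries//; last first.
  by move=> n; apply/measurable_EFinP; apply: measurable_funTS; exact: mf.
under eq_eseriesr do rewrite fI.
exact: eseries_EFin.
Qed.

End BetaIntegral.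

(** * The binomial series and its alternating truncations *)

Section Binomial.
Variable R : realType.
Local Notation mu := (@lebesgue_measure R).
Local Notation D := (`]0%R, +oo[%classic : set R).

(* Both sides times [Gamma p] are the integral of
   [s ^ (p - 1) * exp (- s) * exp (x s)]; the left side integrates the
   exponential series termwise. *)
Lemma binomial_series (p x : R) : 0 < p -> 0 <= x < 1 ->
  series (fun n => pochhammer p n / n`!%:R * x ^+ n) @ \oo --> (1 - x) `^ (- p).
Proof.
move=> p0 /andP[x0 x1]; have x1' : 0 < 1 - x by rewrite subr_gt0.
have G0 : 0 < Gamma p by exact: Gamma_gt0.
pose a n := pochhammer p n / n`!%:R * x ^+ n.
have a0 n : 0 <= a n by rewrite mulr_ge0 ?exprn_ge0// divr_ge0 ?pochhammer_ge0// ltW.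
pose f (n : nat) (s : R) := gamma_integrand p 1 s * (x * s) ^+ n / n`!%:R.
have fI n : (\int[mu]_(s in D) (f n s)%:E = (a n * Gamma p)%:E)%E.
  transitivity (\int[mu]_(s in D) ((x ^+ n / n`!%:R)%:E * (gamma_integrand (p + n%:R) 1 s)%:E))%E.
    apply: eq_integral => s; rewrite inE/= in_itv/= andbT => s0.
    rewrite -EFinM; congr EFin; rewrite /f /gamma_integrand.
    have -> : s `^ (p + n%:R - 1) = s `^ (p - 1) * s ^+ n.
      rewrite -powR_mulrn ?(ltW s0)// -powRD ?(gt_eqF s0) ?implybT//.
      by congr (_ `^ _); ring.
    rewrite exprMn; ring.
  rewrite ge0_integralZl_EFin ?divr_ge0 ?exprn_ge0//; last 2 first.
  - by move=> s _; rewrite lee_fin gamma_integrand_ge0.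
  - by apply/measurable_EFinP; apply: measurable_funTS; exact: measurable_gamma_integrand.
  have pn0 : 0 < p + n%:R by rewrite ltr_pwDl.
  rewrite integral_gamma_integrand// powR1 mul1r -EFinM Gamma_pochhammer//.
  rewrite /a; congr EFin; have alg (b c d e : R) : b / c * (d * e) = d / c * b * e by ring.
  exact: alg.
have mf n : measurable_fun setT (f n).
  apply: measurable_funM => //; apply: measurable_funM.
    exact: measurable_gamma_integrand.
  by apply: measurable_funX; exact: mulrl_measurable.
have f0 n s : 0 < s -> 0 <= f n s.
  move=> s0; rewrite mulr_ge0 ?invr_ge0// mulr_ge0 ?gamma_integrand_ge0// exprn_ge0//.
  by rewrite mulr_ge0// ltW.
have fF s : 0 < s -> series (f^~ s) @ \oo --> gamma_integrand p (1 - x) s.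
  move=> s0; have := @is_cvg_series_exp_coeff R (x * s) => h.
  have -> : gamma_integrand p (1 - x) s = gamma_integrand p 1 s * expR (x * s).
    rewrite /gamma_integrand -mulrA -expRD; congr (_ * expR _); ring.
  have -> : f^~ s = (fun n => gamma_integrand p 1 s * exp_coeff (x * s) n).
    by apply/funext => n; rewrite /f /exp_coeff/= mulrA.
  exact: cvg_seriesMl.
have h : (\sum_(0 <= n <oo) (a n * Gamma p)%:E = ((1 - x) `^ (- p) * Gamma p)%:E)%E.
  rewrite -integral_gamma_integrand//.
  transitivity (\sum_(0 <= n <oo) \int[mu]_(s in D) (f n s)%:E)%E.
    by apply: eq_eseriesr => n _; rewrite fI.
  rewrite -integral_nneseries//.
  - apply: eq_integral => s; rewrite inE/= in_itv/= andbT => s0.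
    exact: eseries_EFin (fF _ s0).
  - by move=> n; apply/measurable_EFinP; apply: measurable_funTS; exact: mf.
  - by move=> n s; rewrite /= in_itv/= andbT lee_fin => /f0.
have {}h : series (fun n => a n * Gamma p) @ \oo --> (1 - x) `^ (- p) * Gamma p.
  by apply: eseries_EFin_cvg h => n; rewrite mulr_ge0// ltW.
have <- : (Gamma p)^-1 * ((1 - x) `^ (- p) * Gamma p) = (1 - x) `^ (- p).
  by rewrite mulrC mulfK ?gt_eqF.
have <- : (fun n => (Gamma p)^-1 * (a n * Gamma p)) =
    (fun n => pochhammer p n / n`!%:R * x ^+ n).
  by apply/funext => n; rewrite mulrC mulfK ?gt_eqF.
exact: cvg_seriesMl.
Qed.

Lemma is_derive_ord_sum (c : nat -> R) (x : R) N :
  is_derive x (1 : R) (fun x => \sum_(n < N.+1) c n * x ^+ n)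
    (\sum_(n < N) c n.+1 * n.+1%:R * x ^+ n).
Proof.
elim: N => [|N IH].
  rewrite big_ord0; under eq_fun do rewrite big_ord1 expr0 mulr1.
  exact: is_derive_cst.
under eq_fun do rewrite big_ord_recr/=; rewrite [X in is_derive _ _ _ X]big_ord_recr/=.
have h : is_derive x (1 : R) (fun x : R => c N.+1 * x ^+ N.+1) (c N.+1 * N.+1%:R * x ^+ N).
  have d0 := @is_deriveX _ _ _ N.+1 _ _ _ (is_derive_id x (1 : R)).
  have d1 := @is_deriveZ _ _ _ _ (c N.+1) _ _ _ d0.
  have -> : (fun x : R => c N.+1 * x ^+ N.+1) = c N.+1 \*: id ^+ N.+1.
    by apply/funext => t; rewrite !fctE.
  suff -> : c N.+1 * N.+1%:R * x ^+ N = c N.+1 *: (N.+1%:R * x ^+ N.+1.-1)%:A by [].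
  by rewrite -![_ *: _]/(_ * _) /= mulr1 mulrA.
exact: (is_deriveD IH h).
Qed.

Lemma binomNS (p : R) n : binomN p n.+1 * n.+1%:R = - p * binomN (p + 1) n.
Proof.
rewrite /binomN pochhammerS factS natrM exprS.
have n0 : n.+1%:R != 0 :> R by rewrite pnatr_eq0.
have f0 : n`!%:R != 0 :> R by rewrite pnatr_eq0 -lt0n fact_gt0.
by field; rewrite f0 nat1r n0.
Qed.

(* By induction on [N]: the derivative of the remainder for [p] is [p] times the
   previous remainder for [p + 1]. *)
Lemma binomial_remainder_sign (p y : R) N : 0 < p -> 0 <= y ->
  0 <= (-1) ^+ N * ((1 + y) `^ (- p) - \sum_(n < N) binomN p n * y ^+ n).
Proof.
elim: N p y => [|N IH] p y p0 y0.
  by rewrite big_ord0 subr0 expr0 mul1r powR_ge0.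
pose F x := (-1) ^+ N.+1 * ((1 + x) `^ (- p) - \sum_(n < N.+1) binomN p n * x ^+ n).
pose F' x := p * ((-1) ^+ N * ((1 + x) `^ (- (p + 1)) - \sum_(n < N) binomN (p + 1) n * x ^+ n)).
have dF (x : R) : 0 <= x -> is_derive x (1 : R) F (F' x).
  move=> x0; have x1 : 0 < 1 + x by rewrite ltr_pwDl.
  have d1 : is_derive x (1 : R) (fun x => 1 + x) (1 : R).
    have := is_deriveD (is_derive_cst (1 : R) x (1 : R)) (is_derive_id x (1 : R)).
    by rewrite add0r.
  have d2 := is_derive1_comp (is_derive1_powR (- p) x1) d1.
  have d3 := is_derive_ord_sum (binomN p) x N.
  have d4 : is_derive x (1 : R) (fun x : R => (1 + x) `^ (- p) - \sum_(n < N.+1) binomN p n * x ^+ n)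
    (- p * (1 + x) `^ (- p - 1) * 1 - \sum_(n < N) binomN p n.+1 * n.+1%:R * x ^+ n).
    exact: is_deriveB.
  have d5 := @is_deriveZ _ _ _ _ ((-1) ^+ N.+1 : R) _ _ _ d4.
  apply: is_derive_eq d5 _.
  rewrite -[_ *: _]/(_ * _) /F' opprD mulr1 exprS.
  under eq_bigr do rewrite binomNS -mulrA.
  by rewrite -mulr_sumr; ring.
have F0 : F 0 = 0.
  rewrite /F addr0 powR1 big_ord_recl big1 ?addr0 => [|i _].
    by rewrite /binomN pochhammer0 !expr0 fact0 divr1 !mulr1 subrr mulr0.
  by rewrite /= /bump leq0n exprS mul0r mulr0.
rewrite -[leRHS]/(F y) -F0.
apply: (@ger0_derive1_ndecry _ F 0) => //.
- move=> x; rewrite in_itv/= andbT => /ltW/dF h; exact: (@ex_derive _ _ _ _ _ _ _ h).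
- move=> x; rewrite in_itv/= andbT => /ltW x0; rewrite derive1E.
  rewrite (@derive_val _ _ _ _ _ _ _ (dF x x0)) mulr_ge0 ?(ltW p0)//.
  by apply: IH => //; rewrite addr_gt0.
- apply: continuous_in_subspaceT => x; rewrite inE/= in_itv/= andbT => /dF.
  exact: is_derive_continuous.
Qed.

Lemma binomial_odd_le (p y : R) N : 0 < p -> 0 <= y -> odd N ->
  (1 + y) `^ (- p) <= \sum_(n < N) binomN p n * y ^+ n.
Proof.
move=> p0 y0 oN; have := binomial_remainder_sign N p0 y0.
by rewrite -signr_odd oN expr1 mulN1r oppr_ge0 subr_le0.
Qed.

End Binomial.

(** * Comparison of limits and exchange of summation in triangular arrays *)

Lemma series_term_bounded (R : realType) (a : nat -> R) :
  cvgn (series a) -> exists M, forall n, a n <= M.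
Proof.
move=> /cvg_series_cvg_0/cvgP/cvg_has_ub[M hM]; exists M => n.
by apply: le_trans (ler_norm _) (hM _ _); exists n.
Qed.

(** The reference sequence [w] need not be known to converge; it will be the row sums shared by two
    expansions. *)
Lemma cvg_eq_of_sub0 (R : realType) (u v w : nat -> CC R) (a b : CC R) :
  (fun n => u n - w n) @ \oo --> (0 : CC R) -> (fun n => v n - w n) @ \oo --> (0 : CC R) ->
  u @ \oo --> a -> v @ \oo --> b -> a = b.
Proof.
move=> uw vw ua vb.
have uv : (fun n => u n - v n) @ \oo --> (0 : CC R).
  rewrite -[0](subrr 0); apply: cvg_trans (cvgB uw vw); apply: near_eq_cvg.
  by apply: nearW => n; rewrite !fctE; ring.
have ab : (fun n => u n - v n) @ \oo --> a - b by apply: cvgB ua vb.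
by apply/eqP; rewrite -subr_eq0; apply/eqP; exact: (cvg_unique (@norm_hausdorff _ _) ab uv).
Qed.

Lemma derivable_translate (R : realType) (f : CC R -> CC R) (a z : CC R) :
  derivable f (a + z) 1 -> derivable (fun x => f (a + x)) z 1.
Proof.
rewrite /derivable => h.
rewrite (_ : (fun h => _) = (fun h => h^-1 *: ((f \o shift (a + z)) (h *: 1) - f (a + z))))//.
by apply/funext => k /=; rewrite addrCA.
Qed.

Section DoubleSeries.
Variable R : realType.
Local Notation C := (CC R).

(** The first [N] rows lie inside the first [N] columns, the array being triangular. What these
    columns contain in addition lies in rows [n >= N] and is dominated by the tail of the row
    bounds. *)
Lemma triangular_swap (A : nat -> nat -> R) (a : nat -> R) (rho : R) (z : C) :
  (forall n k, 0 <= A n k) -> (forall n k, (n < k)%N -> A n k = 0) ->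
  (forall k, series (A^~ k) @ \oo --> a k) -> modulus z <= rho ->
  cvgn (series (fun n => \sum_(k < n.+1) A n k * rho ^+ k)) ->
  (fun N => series (fun k => ofR (a k) * z ^+ k) N
    - series (fun n => \sum_(k < n.+1) ofR (A n k) * z ^+ k) N) @ \oo --> (0 : C).
Proof.
move=> A0 Az Aa zrho; set B := fun n => \sum_(k < n.+1) A n k * rho ^+ k => cB.
have rho0 : 0 <= rho by apply: le_trans zrho.
have Bt : (fun N => limn (series B) - series B N) @ \oo --> 0.
  by rewrite -(subrr (limn (series B))); apply: cvgB cB; exact: cvg_cst.
apply/cvg_modulusP; apply: cvg_le0 Bt => N; rewrite modulus_ge0/= subr0.
have cL : (fun M => \sum_(0 <= k < N) ofR (series (A^~ k) (M + N)%N) * z ^+ k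
    - series (fun n => \sum_(k < n.+1) ofR (A n k) * z ^+ k) N) @ \oo -->
    series (fun k => ofR (a k) * z ^+ k) N
    - series (fun n => \sum_(k < n.+1) ofR (A n k) * z ^+ k) N.
  apply: cvgB; last exact: cvg_cst.
  apply: cvg_big => [|k _]; first exact: add_continuous.
  apply: cvgM; last exact: cvg_cst.
  apply/cvg_modulusP; under eq_fun do rewrite -ofRN -ofRD modulus_ofR.
  apply/norm_cvg0P/subr_cvg0; rewrite (cvg_shiftn N (series (A^~ k))); exact: Aa.
apply: (modulus_lim_le cL).
  apply: (@cvgB _ _ _ _ _ (fun n => series B (n + N)%N) (fun=> series B N)).
    by rewrite (cvg_shiftn N (series B)); exact: cB.
  exact: cvg_cst.
move=> M; rewrite -[leRHS]/(series B (M + N)%N - series B N) series_addn.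
rewrite [leRHS]addrAC subrr add0r.
have extB (n : nat) (F : nat -> C) : (forall k, (n < k)%N -> F k = 0) -> (n < N)%N ->
    \sum_(k < n.+1) F k = \sum_(0 <= k < N) F k.
  move=> F0 nN; rewrite -(big_mkord xpredT) (@big_cat_nat _ _ _ n.+1 0%N N)//=.
  by rewrite [X in _ + X]big1_seq ?addr0// => k; rewrite mem_index_iota => /andP[_ /andP[/F0]].
have -> : series (fun n => \sum_(k < n.+1) ofR (A n k) * z ^+ k) N =
   \sum_(0 <= k < N) \sum_(0 <= n < N) ofR (A n k) * z ^+ k.
  rewrite exchange_big/= /series/= !big_nat; apply: eq_bigr => n /andP[_ nN].
  by apply: extB nN => k /Az ->; rewrite mul0r.
rewrite -sumrB.
have -> : \sum_(0 <= k < N) (ofR (series (A^~ k) (M + N)%N) * z ^+ k -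
     \sum_(0 <= n < N) ofR (A n k) * z ^+ k) =
   \sum_(N <= n < M + N) \sum_(0 <= k < N) ofR (A n k) * z ^+ k.
  rewrite [RHS]exchange_big/=; apply: eq_bigr => k _.
  rewrite series_addn ofRD mulrDl /series/= !ofR_sum !mulr_suml.
  by rewrite addrAC subrr add0r.
rewrite (le_trans (modulus_sum _ _ _))// big_nat [leRHS]big_nat.
apply: ler_sum => n /andP[Nn _].
rewrite (le_trans (modulus_sum _ _ _))// /B -(big_mkord xpredT (fun k => A n k * rho ^+ k)).
rewrite [leRHS](@big_cat_nat _ _ _ N)//=; last exact: leqW.
rewrite -[leLHS]addr0; apply: lerD; last first.
  by apply: sumr_ge0 => k _; rewrite mulr_ge0 ?exprn_ge0.
apply: ler_sum => k _; rewrite modulusM modulus_ofR ger0_norm// modulusX.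
by apply: ler_wpM2l => //; apply: lerXn2r; rewrite ?nnegrE.
Qed.

End DoubleSeries.

(** * The value of 2F1 at -1 by recentering *)

Section Hyp2F1.
Variable R : realType.
Local Notation C := (CC R).
Variables p q s : R.
Hypotheses (p0 : 0 < p) (q0 : 0 < q) (s0 : 0 < s).

(** [e n] is the coefficient of [(1 + t z)^n] in the expansion of [(1 - t z)^(- p)]. For the beta
    density with parameters [q], [s], the numbers [w n j] and [m k] below are the means of
    [t^j (1 - t)^(n - j)] and of [t^k]. *)
Let e (n : nat) : R := 2 `^ (- p) * (pochhammer p n / n`!%:R * 2^-1 ^+ n).
Let w (n j : nat) : R :=
  pochhammer q j * pochhammer s (n - j) / pochhammer (q + s) n.
Let m (k : nat) : R := pochhammer q k / pochhammer (q + s) k.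

Let e_ge0 n : 0 <= e n.
Proof.
by rewrite mulr_ge0 ?powR_ge0// mulr_ge0 ?exprn_ge0// divr_ge0 ?pochhammer_ge0// ltW.
Qed.

Let r0 : 0 < q + s. Proof. exact: addr_gt0. Qed.

Let m_ge0 k : 0 <= m k.
Proof. by rewrite divr_ge0 ?pochhammer_ge0 ?(ltW q0) ?(ltW r0). Qed.

Let m_le1 k : m k <= 1.
Proof.
rewrite ler_pdivrMr ?pochhammer_gt0// mul1r; apply: ler_prod => i _.
by rewrite addr_ge0 ?(ltW q0)//= lerD2r lerDl ltW.
Qed.

Let w_ge0 n j : 0 <= w n j.
Proof.
by rewrite divr_ge0 ?mulr_ge0 ?pochhammer_ge0 ?(ltW q0) ?(ltW s0) ?(ltW r0).
Qed.

Let qs0 k : q + s + k%:R != 0.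
Proof. by rewrite gt_eqF// ltr_pwDl. Qed.

Let em_ge0 n k : 0 <= e n * ('C(n, k)%:R * m k).
Proof. exact: mulr_ge0 (e_ge0 n) (mulr_ge0 (ler0n _ _) (m_ge0 k)). Qed.

Let ew_ge0 n k : 0 <= e n * ('C(n, k)%:R * w n k).
Proof. exact: mulr_ge0 (e_ge0 n) (mulr_ge0 (ler0n _ _) (w_ge0 n k)). Qed.

(** The recentering identity at [z = 0]: the weights form the beta-binomial distribution. *)
Let sum_w n : \sum_(j < n.+1) 'C(n, j)%:R * w n j = 1.
Proof.
have h := @sum_pochhammer_recenter R q s 0 n qs0.
transitivity (\sum_(j < n.+1) 'C(n, j)%:R * (w n j * (1 + 0) ^+ j)).
  by apply: eq_bigr => j _; rewrite addr0 expr1n mulr1.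
rewrite -h big_ord_recl big1 ?addr0 => [|i _].
  by rewrite /= bin0 !pochhammer0 expr0 divr1 !mulr1.
by rewrite /= /bump leq0n exprS mul0r !mulr0.
Qed.

Let Cw_le1 n j : 'C(n, j)%:R * w n j <= 1.
Proof.
have [nj|jn] := ltnP n j; first by rewrite bin_small// mul0r.
have jn' : (j < n.+1)%N by [].
rewrite -[leRHS](sum_w n) (bigD1 (Ordinal jn'))//= lerDl sumr_ge0// => i _.
exact: mulr_ge0.
Qed.

Let sum_bin (rho : R) n : \sum_(k < n.+1) 'C(n, k)%:R * rho ^+ k = (1 + rho) ^+ n.
Proof.
rewrite addrC exprD1n; apply: eq_bigr => i _; by rewrite mulr_natl.
Qed.

Let e_summable (x : R) : 0 <= x < 2 -> cvgn (series (fun n => e n * x ^+ n)).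
Proof.
move=> /andP[x0 x2].
have : 0 <= x / 2 < 1 by rewrite divr_ge0//= ltr_pdivrMr// mul1r.
move=> /(binomial_series p0) h; have /cvgP := @cvg_seriesMl _ _ (2 `^ (- p)) _ h.
set u := (X in cvgn (series X)); set v := (X in _ -> cvgn (series X)).
suff -> : u = v by []; rewrite {}/u {}/v /e; apply/funext => n.
rewrite exprMn; ring.
Qed.

(** Coefficient of [y^k] in [(1 - y)^(- p) = sum e n (1 + y)^n]. The terms [n < k] vanish, and the
    others form the binomial series of parameter [p + k] at 1/2. *)
Let sum_e_bin k : series (fun n => e n * 'C(n, k)%:R) @ \oo --> pochhammer p k / k`!%:R.
Proof.
rewrite -(cvg_shiftn k).
have -> : [sequence series (fun n => e n * 'C(n, k)%:R) (n + k)%N]_n =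
  series (fun n => pochhammer p k / k`!%:R * 2^-1 ^+ k * 2 `^ (- p) *
     (pochhammer (p + k%:R) n / n`!%:R * 2^-1 ^+ n)).
  apply/funext => n; rewrite /= /series/= (@big_cat_nat _ _ _ k 0%N)//= ?leq_addl//.
  rewrite [X in X + _]big1_seq ?add0r => [|i]; last first.
    by rewrite mem_index_iota => /andP[_ ik]; rewrite bin_small ?mulr0.
  rewrite -{1}[k]add0n big_addn addnK; apply: eq_bigr => i _.
  rewrite /e addnC pochhammerD exprD.
  have := bin_fact (leq_addr i k); rewrite addKn => /(congr1 (fun n => n%:R : R)).
  rewrite !natrM => h.
  have f1 : k`!%:R != 0 :> R by rewrite pnatr_eq0 -lt0n fact_gt0.
  have f2 : i`!%:R != 0 :> R by rewrite pnatr_eq0 -lt0n fact_gt0.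
  have f3 : (k + i)`!%:R != 0 :> R by rewrite pnatr_eq0 -lt0n fact_gt0.
  have -> : 'C(k + i, k)%:R = (k + i)`!%:R / k`!%:R / i`!%:R :> R.
    by rewrite -h; field; rewrite f1 f2.
  by field; rewrite f1 f2 f3.
have pk0 : 0 < p + k%:R by rewrite ltr_pwDl.
have /(binomial_series pk0) : 0 <= (2^-1 : R) < 1 by lra.
have -> : 1 - 2^-1 = 2^-1 :> R by field.
move=> hb.
set k0 := pochhammer p k / k`!%:R * 2^-1 ^+ k * 2 `^ (- p).
have -> : pochhammer p k / k`!%:R = k0 * 2^-1 `^ (- (p + k%:R)).
  have h2 : (2^-1 : R) != 0 by rewrite invr_eq0 pnatr_eq0.
  have -> : 2^-1 `^ (- (p + k%:R)) = 2^-1 `^ (- p) * 2^-1 ^- k.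
    by rewrite opprD powRD ?h2 ?implybT// powR_invn.
  rewrite /k0.
  have -> : pochhammer p k / k`!%:R * 2^-1 ^+ k * 2 `^ (- p) * (2^-1 `^ (- p) * 2^-1 ^- k) =
    pochhammer p k / k`!%:R * (2 `^ (- p) * 2^-1 `^ (- p)) * (2^-1 ^+ k * 2^-1 ^- k) :> R.
    ring.
  rewrite -powRM// mulfV ?pnatr_eq0// powR1 mulr1.
  by rewrite mulfV ?mulr1// expf_neq0.
exact: cvg_seriesMl.
Qed.

Let c (k : nat) : R := pochhammer p k / k`!%:R * m k.
Let d (j : nat) : R := limn (series (fun n => e n * ('C(n, j)%:R * w n j))).

Let d_cvg j : series (fun n => e n * ('C(n, j)%:R * w n j)) @ \oo --> d j.
Proof.
have e1 : cvgn (series e).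
  have /e_summable : 0 <= (1 : R) < 2 by rewrite ler01/= ltr1n.
  by under eq_fun do rewrite expr1n mulr1.
suff : cvgn (series (fun n => e n * ('C(n, j)%:R * w n j))) by [].
apply: series_le_cvg e1 => [n|n|n]; [exact: ew_ge0|exact: e_ge0|].
by rewrite -[leRHS]mulr1; apply: ler_wpM2l.
Qed.

(** [e n] times the mean of [(1 + t z)^n]: the row sum common to the expansions in powers of [z] and
    of [1 + z]. *)
Let P (z : C) n : C := \sum_(k < n.+1) ofR (e n * ('C(n, k)%:R * m k)) * z ^+ k.

Let P_recenter z n :
  P z n = \sum_(j < n.+1) ofR (e n * ('C(n, j)%:R * w n j)) * (1 + z) ^+ j.
Proof.
have qsC k : ofR q + ofR s + k%:R != 0 :> C.
  by rewrite -ofRD -ofR_nat -ofRD -modulus_eq0 modulus_ofR normr_eq0.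
have := @sum_pochhammer_recenter C (ofR q) (ofR s) z n qsC.
move=> /(congr1 (fun x => ofR (e n) * x)); rewrite !mulr_sumr => h.
rewrite /P; transitivity (\sum_(k < n.+1) ofR (e n) * ('C(n, k)%:R *
    (pochhammer (ofR q) k / pochhammer (ofR q + ofR s) k * z ^+ k))).
  apply: eq_bigr => k _.
  by rewrite /m -ofRD !pochhammer_ofR -ofRV -ofR_nat !ofRM !mulrA.
rewrite h; apply: eq_bigr => k _.
by rewrite /w -ofRD !pochhammer_ofR -ofRV -ofR_nat !ofRM !mulrA.
Qed.

(** The rows are bounded by [e n (1 + |z|)^n], summable because [1 + |z| < 2]. *)
Lemma hyp_series_swap (z : C) : unit_disc z ->
  (fun N => series (fun k => ofR (c k) * z ^+ k) N - series (P z) N) @ \oo --> (0 : C).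
Proof.
move=> z1; rewrite /P.
apply: (@triangular_swap _ (fun n k => e n * ('C(n, k)%:R * m k)) c (modulus z)) => //.
- by move=> n k nk; rewrite bin_small// mul0r mulr0.
- move=> k; have -> : (fun n => e n * ('C(n, k)%:R * m k)) = (fun n => m k * (e n * 'C(n, k)%:R)).
    by apply/funext => n; ring.
  by rewrite /c mulrC; exact: cvg_seriesMl.
- have z2 : 0 <= 1 + modulus z < 2.
    by rewrite addr_ge0//=; have : modulus z < 1 := z1; lra.
  apply: series_le_cvg (e_summable z2) => n.
  + by apply: sumr_ge0 => k _; rewrite mulr_ge0 ?exprn_ge0.
  + by rewrite mulr_ge0 ?exprn_ge0 ?addr_ge0.
  + rewrite -sum_bin mulr_sumr; apply: ler_sum => k _; rewrite -mulrA.
    apply: ler_wpM2l => //; apply: ler_wpM2r; first exact: exprn_ge0.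
    by rewrite -[leRHS]mulr1; apply: ler_wpM2l.
Qed.

Lemma recentered_series_swap (z : C) : modulus (1 + z) < 2 ->
  (fun N => series (fun k => ofR (d k) * (1 + z) ^+ k) N - series (P z) N) @ \oo --> (0 : C).
Proof.
move=> z2; under eq_fun do rewrite (funext (P_recenter z)).
(* The maximum with 1 gives [rho^k <= rho^n] for [k <= n], so that [sum_w] bounds the n-th row by
   [e n rho^n]. *)
pose rho := Num.max 1 (modulus (1 + z)).
have rho1 : 1 <= rho by rewrite le_max lexx.
apply: (@triangular_swap _ (fun n k => e n * ('C(n, k)%:R * w n k)) d rho) => //.
- by move=> n k nk; rewrite bin_small// mul0r mulr0.
- by rewrite le_max lexx orbT.
- have rho2 : 0 <= rho < 2.
    by rewrite (le_trans _ rho1)//= gt_max z2 ltr1n.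
  apply: series_le_cvg (e_summable rho2) => n.
  + by apply: sumr_ge0 => k _; rewrite mulr_ge0 ?exprn_ge0 ?(le_trans _ rho1).
  + by rewrite mulr_ge0 ?exprn_ge0 ?(le_trans _ rho1).
  + have -> : e n * rho ^+ n = \sum_(k < n.+1) e n * ('C(n, k)%:R * w n k) * rho ^+ n.
      by rewrite -mulr_suml -mulr_sumr sum_w mulr1.
    apply: ler_sum => k _; apply: ler_wpM2l; first exact: ew_ge0.
    by apply: ler_weXn2l => //; rewrite -ltnS.
Qed.

Let pow_bounded_c : pow_bounded 1 (fun k => ofR (c k)).
Proof.
move=> rho rho01; have /cvgP/series_term_bounded[M hM] := binomial_series p0 rho01.
have /andP[rho0 _] := rho01.
exists M => n; apply: le_trans (hM n).
have pn : 0 <= pochhammer p n / n`!%:R by rewrite divr_ge0 ?pochhammer_ge0// ltW.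
have cn0 : 0 <= c n by exact: mulr_ge0 pn (m_ge0 n).
rewrite modulus_ofR (ger0_norm cn0).
apply: ler_wpM2r; first exact: exprn_ge0.
by rewrite -[leRHS]mulr1; apply: ler_wpM2l.
Qed.

(** Only the terms [n >= j] of [d j] are nonzero; times [rho^j] each is at most [e n M^n] with
    [M = max 1 rho < 2]. *)
Let pow_bounded_d : pow_bounded 2 (fun k => ofR (d k)).
Proof.
move=> rho /andP[rho0 rho2]; pose M := Num.max 1 rho.
have M1 : 1 <= M by rewrite le_max lexx.
have M02 : 0 <= M < 2 by rewrite (le_trans _ M1)//= gt_max rho2 ltr1n.
have M0 : 0 <= M by case/andP: M02.
have cM := e_summable M02.
exists (limn (series (fun n => e n * M ^+ n))) => j.
have d0 : 0 <= d j.
  apply: (ge_cvg (@d_cvg j)) => n; apply: sumr_ge0 => i _; exact: ew_ge0.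
rewrite modulus_ofR (ger0_norm d0).
have h : (fun n => series (fun n => e n * ('C(n, j)%:R * w n j)) n * rho ^+ j) @ \oo -->
    d j * rho ^+ j by apply: cvgM; [exact: d_cvg|exact: cvg_cst].
apply: (le_cvg h) => n.
apply: (@le_trans _ _ (series (fun n => e n * M ^+ n) n)).
  rewrite /series/= mulr_suml; apply: ler_sum => i _; rewrite -[leLHS]mulrA.
  apply: ler_wpM2l; first exact: e_ge0.
  have [ij|ji] := ltnP i j; first by rewrite bin_small// !mul0r exprn_ge0.
  rewrite -[leRHS]mul1r; apply: ler_pM; rewrite ?exprn_ge0 ?Cw_le1//.
    exact: mulr_ge0.
  apply: (@le_trans _ _ (M ^+ j)); last exact: ler_weXn2l.
  by apply: lerXn2r; rewrite ?nnegrE// le_max lexx orbT.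
apply: nondecreasing_cvgn_le; last exact: cM.
apply: nondecreasing_series => i _ _.
by rewrite mulr_ge0 ?exprn_ge0.
Qed.

Let F (z : C) : C := psum (fun k => ofR (d k)) (1 + z).

Let hypE (z : C) : unit_disc z ->
  hypergeometric [:: ofR p; ofR q] [:: ofR (q + s)] z = psum (fun k => ofR (c k)) z.
Proof.
move=> z1; rewrite /hypergeometric /psum; congr (limn (series _)).
apply/funext => n; rewrite !big_cons !big_nil !mulr1 !pochhammer_ofR pochhammer1.
rewrite -!ofRM -ofRV -ofRM; congr (ofR _ * _).
by rewrite /c /m invfM; ring.
Qed.

Let disc_lt2 (z : C) : unit_disc z -> modulus (1 + z) < 2.
Proof.
move=> z1; rewrite (le_lt_trans (modulusD _ _))// modulus1.
by have : modulus z < 1 := z1; lra.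
Qed.

Let F_disc (z : C) : unit_disc z ->
  F z = hypergeometric [:: ofR p; ofR q] [:: ofR (q + s)] z.
Proof.
move=> z1; rewrite (hypE z1).
apply: cvg_eq_of_sub0 (recentered_series_swap (disc_lt2 z1)) (hyp_series_swap z1) _ _.
  exact: (pow_bounded_cvg pow_bounded_d (disc_lt2 z1)).
exact: (pow_bounded_cvg pow_bounded_c z1).
Qed.

Let F_derivable (z : C) : modulus (1 + z) < 2 -> derivable F z 1.
Proof.
move=> z2; have [h _] := psum_is_derive pow_bounded_d z2.
by apply: derivable_translate.
Qed.

Let open_U : open [set z : C | modulus (1 + z) < 2].
Proof.
rewrite openE => z /= z2; apply/nbhs_ballP; exists (ofR (2 - modulus (1 + z))) => /=.
  by rewrite -ofR0 ltr_ofR subr_gt0.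
move=> y; rewrite /ball/= normCE ltr_ofR ltrBrDr modulus_distC => h.
rewrite (_ : 1 + y = (y - z) + (1 + z)); last by ring.
exact: le_lt_trans (modulusD _ _) h.
Qed.

Let star_U : star_shaped [set z : C | modulus (1 + z) < 2].
Proof.
move=> z t /= z2 /andP[t0 t1].
have -> : 1 + ofR t * z = ofR (1 - t) + ofR t * (1 + z).
  by rewrite ofRD ofRN; ring.
rewrite (le_lt_trans (modulusD _ _))// modulusM !modulus_ofR (ger0_norm t0).
rewrite ger0_norm ?subr_ge0//; have := modulus_ge0 (1 + z); nra.
Qed.

Let continued_F : continued_hyp2F1 (ofR p) (ofR q) (ofR (q + s)) (-1) (F (-1)).
Proof.
exists [set z : C | modulus (1 + z) < 2], F; split; split => //.
by rewrite /= subrr modulus0.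
Qed.

(** Any two continuations agree on the unit disc, and -1 is the limit of its points
    [-1 + 1 / (n + 2)], so continuity at -1 settles the value. *)
Let continued_unique (v : C) :
  continued_hyp2F1 (ofR p) (ofR q) (ofR (q + s)) (-1) v -> v = F (-1).
Proof.
move=> [U [G [[_ _ _ UN1] [Gd Gdisc <-]]]].
move: F_disc F_derivable; generalize F => H Hdisc Hd.
pose x (n : nat) : C := ofR (harmonic n.+1 - 1).
have x1 : x @ \oo --> (-1 : C).
  apply/cvg_modulusP; have := @cvg_harmonic R; rewrite -cvg_shiftS.
  apply: cvg_le0 => n; rewrite modulus_ge0/= /x opprK -ofR1 -ofRD subrK.
  by rewrite modulus_ofR ger0_norm ?invr_ge0.
have xd n : unit_disc (x n).
  rewrite /unit_disc/= /x modulus_ofR distrC.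
  have k1 : n.+2%:R^-1 < 1 :> R by rewrite invf_lt1 ?ltr0n// ltr1n.
  have k0 : 0 < n.+2%:R^-1 :> R by rewrite invr_gt0 ltr0n.
  by rewrite ger0_norm /harmonic/= ?subr_ge0 ?ltW// ltrBlDr ltrDl.
have lim (K : C -> C) : derivable K (-1) 1 -> (fun n => K (x n)) @ \oo --> K (-1).
  move=> /derivable1_diffP/differentiable_continuous Kc.
  exact: (continuous_cvg _ Kc x1).
have h1 := lim _ (Gd _ UN1).
have h2 : derivable H (-1) 1 by apply: Hd; rewrite subrr modulus0.
have {}h2 := lim _ h2.
have e12 : (fun n => G (x n)) = (fun n => H (x n)).
  by apply/funext => n; rewrite (Gdisc _ (xd n)) (Hdisc _ (xd n)).
rewrite e12 in h1; exact: (cvg_unique (@norm_hausdorff _ _) h1 h2).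
Qed.

(** At -1 only the constant term [d 0] of the series in powers of [1 + z] survives. Its terms are
    positive: it is Euler's integral with [(1 + t)^(- p)] expanded in powers of [(1 - t) / 2]. *)
Lemma hyp2F1_at_N1_series :
  series (fun n => 2 `^ (- p) * (pochhammer p n / n`!%:R * 2^-1 ^+ n) *
     (pochhammer s n / pochhammer (q + s) n)) @ \oo --> hyp2F1_at_N1 p q (q + s).
Proof.
have -> : hyp2F1_at_N1 p q (q + s) = d 0%N.
  rewrite /hyp2F1_at_N1 /hyp2F1; case: xgetP => [y _ /continued_unique ->|].
    by rewrite /F subrr psum0.
  by move=> /(_ _ continued_F).
have := @d_cvg 0%N; rewrite /w; under eq_fun do rewrite bin0 pochhammer0 subn0 !mul1r.
by [].
Qed.

End Hyp2F1.

(** * The integral inequality behind the alternating sums *)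

Section MainInequality.
Variable R : realType.
Local Notation mu := (@lebesgue_measure R).
Local Notation D := (`]0%R, +oo[%classic : set R).
Variables al b g : R.
Hypotheses (al0 : 0 < al) (b0 : 0 < b) (g0 : 0 < g).

(** The variable [t], written as a real power so that measurability is immediate. *)
Let T (w : R) : R := (1 + w) `^ (-1).

Let TE w : 0 < w -> T w = (1 + w)^-1.
Proof. by move=> w0; rewrite /T powR_inv1// addr_ge0// ltW. Qed.

Let T_itv w : 0 < w -> 0 < T w < 1.
Proof.
move=> w0; have w1 : 0 < 1 + w by rewrite addr_gt0.
by rewrite TE// invr_gt0 w1/= invf_lt1// ltrDl.
Qed.

Let onemT w : 0 < w -> 1 - T w = w / (1 + w).
Proof.
move=> w0; have w1 : 1 + w != 0 by rewrite gt_eqF// addr_gt0.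
by rewrite TE//; field.
Qed.

Let binomial_partial_le (x : R) M : 0 <= x < 1 ->
  \sum_(n < M) pochhammer al n / n`!%:R * x ^+ n <= (1 - x) `^ (- al).
Proof.
move=> x01; have h := binomial_series al0 x01; have /andP[x0 _] := x01.
have h2 := cvgP _ h.
rewrite -(cvg_lim (@norm_hausdorff _ _) h).
have -> : \sum_(n < M) pochhammer al n / n`!%:R * x ^+ n =
  series (fun n => pochhammer al n / n`!%:R * x ^+ n) M by rewrite /series/= big_mkord.
apply: nondecreasing_cvgn_le h2 _; apply: nondecreasing_series => n _ _.
by rewrite mulr_ge0 ?exprn_ge0// divr_ge0 ?pochhammer_ge0// ltW.
Qed.

(* With [t = T w], [1 - t ^ 4 = (1 - t) (1 + t) (1 + t ^ 2)], and only the factor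
   [(1 + t ^ 2) ^ (- al)] is expanded, up to an odd, hence upper, partial sum. *)
Let kernel_le (w : R) M N : 0 < w -> odd N ->
  \sum_(n < M) pochhammer al n / n`!%:R * beta_integrand (b + (4 * n)%:R) (al + g) w <=
  \sum_(n < N) binomN al n *
    ((1 + T w) `^ (- al) * beta_integrand (b + (2 * n)%:R) g w).
Proof.
move=> w0 oN; have /andP[t0 t1] := T_itv w0.
set t := T w in t0 t1 *.
have t40 : 0 <= t ^+ 4 < 1 by rewrite exprn_ge0 ?(ltW t0)//= exprn_ilt1 ?(ltW t0).
have p1 : 0 < 1 + t by rewrite addr_gt0.
have p2 : 0 <= t ^+ 2 by rewrite exprn_ge0 ?ltW.
have p3 : 0 < 1 - t by rewrite subr_gt0.
have B0 := beta_integrand_ge0 b (al + g) w.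
have -> : \sum_(n < M) pochhammer al n / n`!%:R * beta_integrand (b + (4 * n)%:R) (al + g) w =
  (\sum_(n < M) pochhammer al n / n`!%:R * (t ^+ 4) ^+ n) * beta_integrand b (al + g) w.
  rewrite mulr_suml; apply: eq_bigr => n _.
  by rewrite beta_integrandDl// -TE// -/t exprM mulrA.
have -> : \sum_(n < N) binomN al n * ((1 + t) `^ (- al) * beta_integrand (b + (2 * n)%:R) g w) =
  (\sum_(n < N) binomN al n * (t ^+ 2) ^+ n) * ((1 + t) `^ (- al) * beta_integrand b g w).
  rewrite mulr_suml; apply: eq_bigr => n _.
  by rewrite beta_integrandDl// -TE// -/t exprM; ring.
(* Lowering the second beta parameter from [al + g] to [g] absorbs the factor [(1 - t)^(- al)] of
   [(1 - t^4)^(- al)]. *)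
have eb : beta_integrand b g w = (1 - t) `^ (- al) * beta_integrand b (al + g) w.
  have q0 : w / (1 + w) != 0 by rewrite gt_eqF// divr_gt0// addr_gt0.
  rewrite [al + g]addrC (beta_integrandDr _ _ al w0) mulrA -(onemT w0) -/t.
  rewrite -powRD; last by rewrite /t (onemT w0) q0 implybT.
  by rewrite addNr powRr0 mul1r.
rewrite eb; apply: (@le_trans _ _ ((1 - t ^+ 4) `^ (- al) * beta_integrand b (al + g) w)).
  by apply: ler_wpM2r => //; exact: binomial_partial_le.
have -> : 1 - t ^+ 4 = (1 + t ^+ 2) * ((1 + t) * (1 - t)) by ring.
have p12 : 0 <= 1 + t ^+ 2 by rewrite addr_ge0.
rewrite (powRM _ p12 (mulr_ge0 (ltW p1) (ltW p3))) (powRM _ (ltW p1) (ltW p3)).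
rewrite -!mulrA; apply: ler_wpM2r; last exact: binomial_odd_le.
by rewrite !mulr_ge0 ?powR_ge0.
Qed.

Let measurable_kernel q s (p : R) :
  measurable_fun setT (fun w => (1 + T w) `^ p * beta_integrand q s w).
Proof.
apply: measurable_funM; last exact: measurable_beta_integrand.
apply: (measurableT_comp (measurable_powR _)); apply: measurable_funD => //.
exact: measurable_1Dpow.
Qed.

(* [(1 + t) ^ (- al) = 2 ^ (- al) * (1 - (1 - t) / 2) ^ (- al)], expanded in powers
   of [1 - t]. *)
Let integral_kernel q : 0 < q ->
  (\int[mu]_(w in D) ((1 + T w) `^ (- al) * beta_integrand q g w)%:E =
   (Beta q g * hyp2F1_at_N1 al q (q + g))%:E)%E.
Proof.
move=> q0; have qg0 : 0 < q + g by exact: addr_gt0.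
pose e n : R := 2 `^ (- al) * (pochhammer al n / n`!%:R * 2^-1 ^+ n).
have e0 n : 0 <= e n.
  by rewrite mulr_ge0 ?powR_ge0// mulr_ge0 ?exprn_ge0// divr_ge0 ?pochhammer_ge0// ltW.
apply: (@integral_series_halfline _ (fun n w => e n * beta_integrand q (g + n%:R) w)
  _ (fun n => e n * Beta q (g + n%:R))).
- by move=> n; apply: measurable_funM => //; exact: measurable_beta_integrand.
- by move=> n w _; rewrite mulr_ge0// beta_integrand_ge0.
- move=> w w0; have /andP[t0 t1] := T_itv w0.
  have x01 : 0 <= (1 - T w) / 2 < 1 by apply/andP; split; lra.
  have h := binomial_series al0 x01.
  have {}h := @cvg_seriesMl _ _ (2 `^ (- al) * beta_integrand q g w) _ h.
  have -> : (1 + T w) `^ (- al) * beta_integrand q g w =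
    2 `^ (- al) * beta_integrand q g w * (1 - (1 - T w) / 2) `^ (- al).
    rewrite mulrAC -powRM//; last by lra.
    by congr (_ `^ _ * _); field.
  rewrite (_ : (fun n => _) = (fun n => 2 `^ (- al) * beta_integrand q g w *
    (pochhammer al n / n`!%:R * ((1 - T w) / 2) ^+ n)))//.
  apply/funext => n; rewrite beta_integrandDr// powR_mulrn -?onemT//; last by lra.
  by rewrite /e !exprMn; ring.
- move=> n; under eq_integral do rewrite EFinM.
  rewrite ge0_integralZl_EFin//; last 2 first.
  + by move=> w _; rewrite lee_fin beta_integrand_ge0.
  + by apply/measurable_EFinP; apply: measurable_funTS; exact: measurable_beta_integrand.
  by rewrite integral_beta_integrand// ltr_pwDl.
- have h := @cvg_seriesMl _ _ (Beta q g) _ (hyp2F1_at_N1_series al0 q0 g0).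
  rewrite (_ : (fun n => _) = (fun n => Beta q g * (2 `^ (- al) *
    (pochhammer al n / n`!%:R * 2^-1 ^+ n) * (pochhammer g n / pochhammer (q + g) n))))//.
  by apply/funext => n; rewrite BetaDr// /e mulrCA.
Qed.

Let integrable_ge0 (f : R -> R) (I : R) : measurable_fun setT f -> (forall w, 0 <= f w) ->
  (\int[mu]_(w in D) (f w)%:E = I%:E)%E -> mu.-integrable D (EFin \o f).
Proof.
move=> mf f0 fI; apply/integrableP; split.
  by apply/measurable_EFinP; apply: measurable_funTS.
rewrite (_ : (\int[_]_(x in _) _)%E = I%:E) ?ltry// -fI.
by apply: eq_integral => w _; rewrite /= ger0_norm.
Qed.

(** [kernel_le] integrated over the half-line; both sums are finite, so linearity and monotonicity
    suffice. In both applications [al + g = c - B]. *)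
Lemma beta_sum_le M N : odd N ->
  \sum_(n < M) pochhammer al n / n`!%:R * Beta (b + (4 * n)%:R) (al + g) <=
  \sum_(n < N) binomN al n * (Beta (b + (2 * n)%:R) g *
     hyp2F1_at_N1 al (b + (2 * n)%:R) (b + (2 * n)%:R + g)).
Proof.
move=> oN.
have ag0 : 0 < al + g by exact: addr_gt0.
have bk k : 0 < b + k%:R by rewrite ltr_pwDl.
have k0 q w : 0 <= (1 + T w) `^ (- al) * beta_integrand q g w.
  by rewrite mulr_ge0 ?powR_ge0 ?beta_integrand_ge0.
have i1 n : mu.-integrable D (EFin \o beta_integrand (b + (4 * n)%:R) (al + g)).
  apply: integrable_ge0 (integral_beta_integrand (bk _) ag0).
    exact: measurable_beta_integrand.
  exact: beta_integrand_ge0.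
have i2 n : mu.-integrable D (EFin \o (fun w => (1 + T w) `^ (- al) * beta_integrand (b + (2 * n)%:R) g w)).
  apply: integrable_ge0 (integral_kernel (bk _)) => //; exact: measurable_kernel.
have lin (K : nat) (c : nat -> R) (f : nat -> R -> R) (I : nat -> R) :
    (forall n, mu.-integrable D (EFin \o f n)) ->
    (forall n, (\int[mu]_(w in D) (f n w)%:E = (I n)%:E)%E) ->
    mu.-integrable D (EFin \o (fun w => \sum_(n < K) c n * f n w)) /\
    \int[mu]_(w in D) (\sum_(n < K) c n * f n w) = \sum_(n < K) c n * I n.
  move=> fi fI; elim: K => [|K [IHi IH]].
    split.
      rewrite (_ : _ \o _ = cst 0%E); last by apply/funext => w; rewrite /= big_ord0.
      exact: integrable0.
    rewrite big_ord0 /Rintegral (_ : (\int[_]_(x in _) _)%E = 0%E)//.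
    by apply: integral0_eq => w _; rewrite big_ord0.
  have ci : mu.-integrable D (EFin \o (fun w => c K * f K w)).
    exact: (integrableZl _ (c K) (fi K)).
  have E : (fun w => \sum_(n < K.+1) c n * f n w) = (fun w => \sum_(n < K) c n * f n w + c K * f K w).
    by apply/funext => w; rewrite big_ord_recr.
  rewrite E; split; first exact: (integrableD _ IHi ci).
  rewrite RintegralD//; rewrite IH big_ord_recr/=; congr (_ + _).
  by rewrite RintegralZl// /Rintegral fI.
have [j1 l1] := lin M (fun n => pochhammer al n / n`!%:R) _ _ i1
  (fun n => integral_beta_integrand (bk _) ag0).
have [j2 l2] := lin N (binomN al) _ _ i2 (fun n => integral_kernel (bk _)).
rewrite -l1 -l2; apply: le_Rintegral => // w.
by rewrite /= in_itv/= andbT => w0; exact: kernel_le.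
Qed.

End MainInequality.

(** * From the hypothesis to the weighted coefficient sum *)

Section CoefficientSum.
Variable R : realType.

(** The odd truncations are the upper bounds; convergence of the whole sequence carries their bound
    to the limit. *)
Lemma ge_cvg_odd (S : nat -> R) (x s : R) : S @ \oo --> s ->
  (forall N, odd N -> x <= S N) -> x <= s.
Proof.
move=> Ss xS; rewrite leNgt; apply/negP => sx.
have [N _ hN] := cvgr_lt _ Ss _ sx.
have h : (N <= N.*2.+1)%N by rewrite -addnn; lia.
have := hN _ h; rewrite /= ltNge xS//=; by rewrite odd_double.
Qed.

Definition kernel_coef (A B c : R) (n : nat) : R :=
  pochhammer A n / n`!%:R * (pochhammer B (4 * n) / pochhammer c (4 * n)).

Lemma kernel_coef_ge0 A B c n : 0 < A -> 0 < B -> 0 < c -> 0 <= kernel_coef A B c n.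
Proof. by move=> *; rewrite mulr_ge0 ?divr_ge0 ?pochhammer_ge0// ltW. Qed.

(** The factor [n + 1] cancels against [(n + 1)!], and extracting [A] from the rising factorial
    leaves the parameter [A + 1] of the first series. *)
Lemma kernel_coefS A B c n : n.+1%:R * kernel_coef A B c n.+1 =
  A * (pochhammer (A + 1) n / n`!%:R *
    (pochhammer B (4 * n.+1) / pochhammer c (4 * n.+1))).
Proof.
rewrite /kernel_coef pochhammerS factS natrM.
have n0 : n.+1%:R != 0 :> R by rewrite pnatr_eq0.
have f0 : n`!%:R != 0 :> R by rewrite pnatr_eq0 -lt0n fact_gt0.
by rewrite !mulrA; congr (_ * _ * _); field; rewrite f0 nat1r n0.
Qed.

Lemma Beta_kernel (B c : R) k : 0 < B -> B < c ->
  pochhammer B k / pochhammer c k =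
  Gamma c / (Gamma B * Gamma (c - B)) * Beta (B + k%:R) (c - B).
Proof.
move=> B0 Bc; have c0 : 0 < c by exact: lt_trans Bc.
have cB0 : 0 < c - B by rewrite subr_gt0.
rewrite /Beta (_ : B + k%:R + (c - B) = c + k%:R); last by ring.
rewrite !Gamma_pochhammer//.
have alg (x y z p q : R) : x != 0 -> y != 0 -> z != 0 -> q != 0 ->
    p / q = x / (y * z) * (p * y * z / (q * x)).
  by move=> x0 y0 z0 q0; field; rewrite x0 y0 z0 q0.
by apply: alg; rewrite gt_eqF ?Gamma_gt0 ?pochhammer_gt0.
Qed.

Section Bound.
Variables A B c lambda beta : R.
Hypotheses (A0 : 0 < A) (B0 : 0 < B) (ABc : A + B + 1 < c) (lambda0 : 0 < lambda).
Variables u v : nat -> R.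
Hypothesis uE : forall n : nat, u n =
    binomN (A + 1) n
    * (Gamma (B + 4 + 2 * n%:R) / Gamma (c - A + 3 + 2 * n%:R))
    * hyp2F1_at_N1 (A + 1) (B + 4 + 2 * n%:R) (c - A + 3 + 2 * n%:R).
Hypothesis vE : forall n : nat, v n =
    binomN A n
    * (Gamma (B + 2 * n%:R) / Gamma (c - A + 2 * n%:R))
    * hyp2F1_at_N1 A (B + 2 * n%:R) (c - A + 2 * n%:R).
Hypotheses (cu : cvgn (series u)) (cv : cvgn (series v)).

Let Bc : B < c. Proof. by have := A0; have := ABc; lra. Qed.
Let c0 : 0 < c. Proof. exact: lt_trans Bc. Qed.
Let g1 : 0 < c - A - B - 1. Proof. by have := ABc; lra. Qed.
Let g0 : 0 < c - A - B. Proof. by have := ABc; lra. Qed.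
Let K0 := Gamma c / (Gamma B * Gamma (c - B)).
Let K0_ge0 : 0 <= K0.
Proof. by rewrite divr_ge0 ?mulr_ge0 ?ltW ?Gamma_gt0 ?subr_gt0. Qed.

Let sum_v M : \sum_(n < M) kernel_coef A B c n <= K0 * Gamma (c - A - B) * limn (series v).
Proof.
apply: (@ge_cvg_odd (fun N => K0 * Gamma (c - A - B) * series v N)).
  by apply: cvgM cv; exact: cvg_cst.
move=> N oN; have := ler_wpM2l K0_ge0 (beta_sum_le A0 B0 g0 M oN).
congr (_ <= _).
  rewrite mulr_sumr; apply: eq_bigr => n _.
  have -> : A + (c - A - B) = c - B by ring.
  by rewrite /kernel_coef (Beta_kernel _ B0 Bc) -/K0 mulrCA.
rewrite -mulrA; congr (_ * _); rewrite /series/= big_mkord mulr_sumr.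
apply: eq_bigr => n _; rewrite vE /Beta natrM.
have -> : B + 2%:R * n%:R + (c - A - B) = c - A + 2%:R * n%:R by ring.
have alg (x y z w t : R) : x * (y * z / w * t) = z * (x * (y / w) * t) by ring.
exact: alg.
Qed.

(** [beta_sum_le] with parameters [A + 1], [B + 4] and [g = c - A - B - 1]. The denominator
    [c - A - B - 1] comes from [Gamma (g + 1) = g Gamma g]. *)
Let sum_u M : \sum_(n < M) n.+1%:R * kernel_coef A B c n.+1 <=
  K0 * Gamma (c - A - B) * (A / (c - A - B - 1) * limn (series u)).
Proof.
have A1 : 0 < A + 1 by rewrite addr_gt0.
have B4 : 0 < B + 4 by rewrite addr_gt0.
have AK : 0 <= A * K0 by rewrite mulr_ge0 ?K0_ge0// ltW.
have GS : Gamma (c - A - B) = (c - A - B - 1) * Gamma (c - A - B - 1).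
  by rewrite -GammaS ?subrK.
have -> : K0 * Gamma (c - A - B) * (A / (c - A - B - 1) * limn (series u)) =
   A * K0 * Gamma (c - A - B - 1) * limn (series u).
  rewrite GS; have g1' : c - A - B - 1 != 0 by rewrite gt_eqF.
  have alg (d k x a l : R) : d != 0 -> k * (d * x) * (a / d * l) = a * k * x * l.
    by move=> d0; field.
  exact: alg.
apply: (@ge_cvg_odd (fun N => A * K0 * Gamma (c - A - B - 1) * series u N)).
  by apply: cvgM cu; exact: cvg_cst.
move=> N oN; have := ler_wpM2l AK (beta_sum_le A1 B4 g1 M oN).
congr (_ <= _).
  rewrite mulr_sumr; apply: eq_bigr => n _; rewrite kernel_coefS -[LHS]mulrA; congr (_ * _).
  have -> : A + 1 + (c - A - B - 1) = c - B by ring.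
  have e4 : B + 4 + (4 * n)%:R = B + (4 * n.+1)%:R.
    by rewrite -addrA -natrD mulnS.
  rewrite e4.
  by rewrite (Beta_kernel _ B0 Bc) -/K0 mulrCA.
rewrite -[RHS]mulrA; congr (_ * _); rewrite /series/= big_mkord mulr_sumr.
apply: eq_bigr => n _; rewrite uE /Beta natrM.
have -> : B + 4 + 2%:R * n%:R + (c - A - B - 1) = c - A + 3 + 2%:R * n%:R by ring.
have alg (x y z w t : R) : x * (y * z / w * t) = z * (x * (y / w) * t) by ring.
exact: alg.
Qed.

Lemma kernel_coef_sum_le M :
  Gamma c * Gamma (c - A - B) / (Gamma B * Gamma (c - B))
  * (A / (c - A - B - 1) * limn (series u) + lambda * limn (series v))
    <= lambda * (1 + 1 / (2 * (1 - beta))) ->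
  \sum_(n < M) (n.+1%:R + lambda) * kernel_coef A B c n.+1 <= lambda / (2 * (1 - beta)).
Proof.
rewrite (mulrAC (Gamma c)) -/K0 mulrDr mulrDr mulr1 mul1r => h.
have hu := sum_u M; have hv := ler_wpM2l (ltW lambda0) (sum_v M.+1).
(* The term [n = 0] of the second sum is 1; its share [lambda] is moved to the right and cancels the
   1 of [1 + 1 / (2 (1 - beta))]. *)
rewrite big_ord_recl /= {1}/kernel_coef !muln0 !pochhammer0 fact0 !divr1 mulr1 mulrDr mulr1 in hv.
under eq_bigr do rewrite mulrDl; rewrite big_split/= -mulr_sumr.
rewrite (mulrCA _ lambda) in h.
apply: le_trans (lerD hu (lexx _)) _.
have {}hv : lambda * (\sum_(n < M) kernel_coef A B c n.+1) <=
   lambda * (K0 * Gamma (c - A - B) * limn (series v)) - lambda.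
  rewrite lerBrDl; apply: le_trans hv; rewrite lerD2l; apply: ler_wpM2l; first exact: ltW.
  by apply: ler_sum => n _.
apply: le_trans (lerD (lexx _) hv) _.
by rewrite addrA lerBlDr [leRHS]addrC.
Qed.

End Bound.
End CoefficientSum.

(** * Coefficient bounds, starlikeness and the operator *)

Section Analytic.
Variable R : realType.
Local Notation C := (CC R).

Lemma nbhs_unit_disc (z : C) : unit_disc z -> nbhs z (@unit_disc R).
Proof.
move=> z1; apply/nbhs_ballP; exists (ofR (1 - modulus z)) => /=.
  by rewrite -ofR0 ltr_ofR subr_gt0.
move=> y; rewrite /ball/= normCE ltr_ofR ltrBrDr modulus_distC => h.
rewrite /unit_disc/= -[y](subrK z); exact: le_lt_trans (modulusD _ _) h.
Qed.

Lemma expands_derive1 u (f : C -> C) z : expands_as u f -> unit_disc z ->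
  derive1 f z = psum (diff_coef u) z.
Proof.
move=> uf z1; have [_ <-] := psum_is_derive (expands_pow_bounded uf) z1.
rewrite derive1E; apply: near_eq_derive.
apply: filterS (nbhs_unit_disc z1) => y y1; exact: expands_psum uf y1.
Qed.

Lemma eq_expands u (f g : C -> C) : (forall z, unit_disc z -> f z = g z) ->
  expands_as u f -> expands_as u g.
Proof. by move=> fg uf z z1; rewrite -fg//; exact: uf. Qed.

Lemma expandsMz u (f : C -> C) : expands_as u f ->
  expands_as (fun n => if n is m.+1 then u m else 0) (fun z => z * f z).
Proof.
move=> uf z z1; rewrite -cvg_shiftS.
rewrite (_ : (fun n => _) = (fun n => z * series (fun n => u n * z ^+ n) n)).
  by apply: cvgM; [exact: cvg_cst|exact: uf].
apply/funext => n; rewrite /series/= big_nat_recl//= mul0r add0r mulr_sumr.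
by apply: eq_bigr => i _; rewrite exprS; ring.
Qed.

Lemma expands_diff u (f : C -> C) : expands_as u f -> expands_as (diff_coef u) (derive1 f).
Proof.
move=> uf; apply: (@eq_expands _ (psum (diff_coef u))).
  by move=> z z1; rewrite (expands_derive1 uf z1).
exact/pow_bounded_expands/pow_bounded_diff/(expands_pow_bounded uf).
Qed.

Lemma expands_z_derive1 u (f : C -> C) : expands_as u f ->
  expands_as (fun n => n%:R * u n) (fun z => z * derive1 f z).
Proof.
move=> uf; have := expandsMz (expands_diff uf); congr (expands_as _ _).
by apply/funext => -[|n]; rewrite ?mul0r.
Qed.

Lemma coeffsE u (f : C -> C) : expands_as u f -> coeffs f = u.
Proof.
move=> uf; rewrite /coeffs; case: xgetP => [v -> vf|/(_ u)//].
exact: (expands_coef_unique vf uf).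
Qed.

(** Caratheodory's bound for [exp (i phi) (f' - beta)], whose constant term has real part
    [(1 - beta) cos phi <= 1 - beta]. *)
Lemma classR_coef beta (f : C -> C) u n : beta < 1 -> expands_as u f -> u 1%N = 1 ->
  classR beta f -> (0 < n)%N -> n.+1%:R * modulus (u n.+1) <= 2 * (1 - beta).
Proof.
move=> beta1 uf u1 [_ [phi hphi]] n0.
pose v k : C := expi phi * (diff_coef u k - (if k == 0%N then ofR beta else 0)).
have vg : expands_as v (fun z => expi phi * (derive1 f z - ofR beta)).
  move=> z z1.
  have h1 := expands_diff uf z1.
  have h2 : series (fun k => (if k == 0%N then ofR beta else 0) * z ^+ k) @ \oo --> ofR beta.
    rewrite -cvg_shiftS (_ : (fun n => _) = cst (ofR beta)); first exact: cvg_cst.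
    apply/funext => k; rewrite /series/= big_nat_recl//= expr0 mulr1 big1 ?addr0// => i _.
    by rewrite mul0r.
  have h3 : (fun N => expi phi * (series (fun k => diff_coef u k * z ^+ k) N -
     series (fun k => (if k == 0%N then ofR beta else 0) * z ^+ k) N)) @ \oo -->
     expi phi * (derive1 f z - ofR beta).
    by apply: cvgM; [exact: cvg_cst|exact: (cvgB h1 h2)].
  rewrite (_ : series _ = (fun N => expi phi * (series (fun k => diff_coef u k * z ^+ k) N -
     series (fun k => (if k == 0%N then ofR beta else 0) * z ^+ k) N)))//.
  apply/funext => N; rewrite /series/= -sumrB mulr_sumr; apply: eq_bigr => k _.
  by rewrite /v -mulrBl mulrA.
have := caratheodory_coef vg hphi n0.
have e1 : modulus (expi phi) = 1.
  by rewrite /modulus /expi normc_def /= cos2Dsin2 sqrtr1.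
rewrite /v (gtn_eqF n0) eqxx subr0 modulusM e1 mul1r /diff_coef u1 modulusM modulus_nat.
move=> /le_trans; apply.
have -> : (1%:R * 1 - ofR beta : C) = ofR (1 - beta) by rewrite mulr1 ofRD ofRN.
rewrite mulrC [expi phi * _]mulrC ReMr mulrC; apply: ler_wpM2l => //.
by rewrite -[leRHS]mulr1; apply: ler_wpM2l; [rewrite subr_ge0 ltW|exact: cos_le1].
Qed.

(** The weighted sum gives [|z h' - h| + lambda |h - z| <= lambda |z|^2]. For [0 < |z| < 1] this is
    below [lambda |z| <= lambda |h| + lambda |h - z|], whence [|z h' - h| < lambda |h|], which also
    excludes zeros of [h]. *)
Lemma starlike_coef lambda k (h : C -> C) : 0 < lambda ->
  expands_as k h -> k 0%N = 0 -> k 1%N = 1 ->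
  (forall N, \sum_(n < N) (n.+1%:R + lambda) * modulus (k n.+2) <= lambda) ->
  starlike lambda h.
Proof.
move=> l0 kh k0 k1 hk; split; first by exists k.
move=> z z1 zN0; have mz1 : modulus z < 1 := z1.
have mz0 : 0 < modulus z by rewrite modulus_gt0.
have key : modulus (z * derive1 h z - h z) + lambda * modulus (h z - z) <= lambda * modulus z ^+ 2.
  have c1 : (fun N => series (fun n => n%:R * k n * z ^+ n) N.+2 -
      series (fun n => k n * z ^+ n) N.+2) @ \oo --> z * derive1 h z - h z.
    apply: cvgB; rewrite (cvg_shiftS (fun N => series _ N.+1)) cvg_shiftS.
      exact: (expands_z_derive1 kh z1).
    exact: kh.
  have c2 : (fun N => series (fun n => k n * z ^+ n) N.+2 - z) @ \oo --> h z - z.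
    apply: cvgB; last exact: cvg_cst.
    by rewrite (cvg_shiftS (fun N => series _ N.+1)) cvg_shiftS; exact: kh.
  have {c1 c2}c3 : (fun N => modulus (series (fun n => n%:R * k n * z ^+ n) N.+2 -
      series (fun n => k n * z ^+ n) N.+2) +
      lambda * modulus (series (fun n => k n * z ^+ n) N.+2 - z)) @ \oo -->
      modulus (z * derive1 h z - h z) + lambda * modulus (h z - z).
    apply: cvgD; first exact: (cvg_modulus c1).
    by apply: cvgM; [exact: cvg_cst|exact: (cvg_modulus c2)].
  apply: (le_cvg c3) => N.
  have -> : series (fun n => n%:R * k n * z ^+ n) N.+2 - series (fun n => k n * z ^+ n) N.+2 =
      \sum_(0 <= n < N) n.+1%:R * k n.+2 * z ^+ n.+2.
    rewrite /series/= -sumrB !big_nat_recl//= k0 k1 !mulr0 !mul0r !mul1r !subrr !add0r.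
    by apply: eq_bigr => n _; rewrite -mulrBl -{2}[k n.+2]mul1r -mulrBl -natr1 addrK.
  have -> : series (fun n => k n * z ^+ n) N.+2 - z = \sum_(0 <= n < N) k n.+2 * z ^+ n.+2.
    rewrite /series/= !big_nat_recl//= k0 k1 mul0r mul1r expr1 add0r.
    by rewrite addrAC subrr add0r.
  have s1 := modulus_sum (index_iota 0 N) xpredT (fun n => n.+1%:R * k n.+2 * z ^+ n.+2).
  have s2 := ler_wpM2l (ltW l0) (modulus_sum (index_iota 0 N) xpredT (fun n => k n.+2 * z ^+ n.+2)).
  apply: le_trans (lerD s1 s2) _.
  apply: (@le_trans _ _ ((\sum_(n < N) (n.+1%:R + lambda) * modulus (k n.+2)) * modulus z ^+ 2)).
    rewrite mulr_sumr -big_split/= big_mkord mulr_suml; apply: ler_sum => n _.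
    rewrite (modulusM _ (z ^+ _)) (modulusM (k _)) (modulusM n.+1%:R) modulus_nat modulusX.
    have -> : n.+1%:R * modulus (k n.+2) * modulus z ^+ n.+2 +
        lambda * (modulus (k n.+2) * modulus z ^+ n.+2) =
        (n.+1%:R + lambda) * modulus (k n.+2) * modulus z ^+ n.+2 by ring.
    apply: ler_wpM2l; first by rewrite mulr_ge0 ?addr_ge0 ?(ltW l0).
    by apply: ler_wiXn2l => //; exact: ltW.
  by apply: ler_wpM2r; rewrite ?exprn_ge0.
have tri : modulus z <= modulus (h z) + modulus (h z - z).
  by rewrite -{1}[z](subKr (h z)); exact: modulusB.
have mhz : modulus (z * derive1 h z - h z) < lambda * modulus (h z).
  have l2 : lambda * modulus z ^+ 2 < lambda * modulus z.
    by rewrite ltr_pM2l// expr2 gtr_pMl.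
  nra.
have hz : h z != 0.
  by rewrite -modulus_gt0 -(pmulr_rgt0 _ l0) (le_lt_trans _ mhz).
split=> //.
have -> : z * derive1 h z / h z - 1 = (z * derive1 h z - h z) / h z.
  by rewrite mulrBl divff.
by rewrite modulusM modulusV ltr_pdivrMr ?modulus_gt0.
Qed.

(** The factors of [(x)_4n] sorted by residue modulo 4. The powers of 4 cancel between numerator and
    denominator of the 5F4 series. *)
Lemma pochhammer_quarter (x : C) n :
  pochhammer (x / 4) n * (pochhammer ((x + 1) / 4) n *
    (pochhammer ((x + 2) / 4) n * pochhammer ((x + 3) / 4) n)) =
  pochhammer x (4 * n) / 4 ^+ (4 * n).
Proof.
elim: n => [|n IH]; first by rewrite muln0 !pochhammer0 expr0 divr1 !mulr1.
have n4 : (4 : C) != 0 by rewrite pnatr_eq0.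
have n4n : (4 : C) ^+ (4 * n) != 0 by rewrite expf_neq0.
rewrite mulnS addnC !addnS addn0 !pochhammerSr !exprSr.
transitivity (pochhammer x (4 * n) / 4 ^+ (4 * n) *
  ((x / 4 + n%:R) * ((x + 1) / 4 + n%:R) * ((x + 2) / 4 + n%:R) * ((x + 3) / 4 + n%:R))).
  by rewrite -IH; ring.
rewrite -!natr1 natrM; move: (4 ^+ (4 * n)) n4n (n%:R) => q q0 m; field.
have -> : 0 + 1 + 1 + 1 + 1 = 4 :> C by ring.
by rewrite expf_neq0.
Qed.

Definition operator_kernel_coef (a b : C) (c : R) (n : nat) : C :=
  pochhammer a n / n`!%:R * (pochhammer b (4 * n) / pochhammer (ofR c) (4 * n)).

Lemma operator_kernel_coefE (a b : C) (c : R) (z : C) : 0 < c ->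
  hypergeometric
       [:: a; b / 4; (b + 1) / 4; (b + 2) / 4; (b + 3) / 4]
       [:: ofR c / 4; (ofR c + 1) / 4; (ofR c + 2) / 4; (ofR c + 3) / 4] z =
  psum (operator_kernel_coef a b c) z.
Proof.
move=> c0; rewrite /hypergeometric /psum; congr (limn (series _)); apply/funext => n.
rewrite !big_cons !big_nil !mulr1 !pochhammer_quarter pochhammer1 /operator_kernel_coef.
have p4 : (4 : C) ^+ (4 * n) != 0 by rewrite expf_neq0// pnatr_eq0.
have n0 : n`!%:R != 0 :> C by rewrite pnatr_eq0 -lt0n fact_gt0.
have pc : pochhammer (ofR c) (4 * n) != 0.
  by rewrite pochhammer_ofR -modulus_gt0 modulus_ofR normr_gt0 gt_eqF// pochhammer_gt0.
congr (_ * _); field; rewrite p4 n0 pc//.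
Qed.

Lemma modulus_operator_kernel_coef (a b : C) (c : R) n : 0 < c ->
  modulus (operator_kernel_coef a b c n) <= kernel_coef (modulus a) (modulus b) c n.
Proof.
move=> c0; rewrite /operator_kernel_coef /kernel_coef !modulusM !modulusV modulus_nat.
rewrite pochhammer_ofR modulus_ofR ger0_norm ?pochhammer_ge0 ?(ltW c0)//.
apply: ler_pM; rewrite ?mulr_ge0 ?invr_ge0 ?pochhammer_ge0 ?(ltW c0)//.
  by apply: ler_wpM2r; rewrite ?invr_ge0// modulus_pochhammer.
by apply: ler_wpM2r; rewrite ?invr_ge0 ?pochhammer_ge0 ?(ltW c0)// modulus_pochhammer.
Qed.

Lemma bounded_pow_bounded (u : nat -> C) (M : R) : (forall n, modulus (u n) <= M) -> pow_bounded 1 u.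
Proof.
move=> uM rho /andP[rho0 rho1]; exists M => n; rewrite -[leRHS]mulr1.
by apply: ler_pM; rewrite ?exprn_ge0// exprn_ile1// ltW.
Qed.

(** The factor [n + 2] from [z I(f)'] pairs with [u (n + 2)] in Caratheodory's bound, leaving
    [2 (1 - beta)] times a kernel coefficient of index [n + 1]; [starlike_coef] then applies to
    [z I(f)']. *)
Lemma convexC_operatorI (a b : C) (c lambda beta : R) (f : C -> C) :
  a != 0 -> b != 0 -> 0 < c -> 0 < lambda -> beta < 1 ->
  (forall M, \sum_(n < M) (n.+1%:R + lambda) *
     kernel_coef (modulus a) (modulus b) c n.+1 <= lambda / (2 * (1 - beta))) ->
  classR beta f -> convexC lambda (operatorI a b (ofR c) f).
Proof.
move=> a0 b0 c0 l0 beta1 hT fR; have [[u [u0 u1 uf]] _] := fR.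
have A0 : 0 < modulus a by rewrite modulus_gt0.
have B0 : 0 < modulus b by rewrite modulus_gt0.
have beta1' : 0 < 1 - beta by rewrite subr_gt0.
pose T n := kernel_coef (modulus a) (modulus b) c n.
have T0 n : 0 <= T n by exact: kernel_coef_ge0.
(* A single term of the weighted sum, its weight being at least [lambda]. This crude bound secures
   convergence in the unit disc. *)
have Tb n : T n.+1 <= (lambda / (2 * (1 - beta))) / lambda.
  rewrite ler_pdivlMr//; apply: le_trans (hT n.+1); rewrite big_ord_recr/=.
  rewrite -[leLHS]add0r; apply: lerD.
    by apply: sumr_ge0 => i _; rewrite mulr_ge0 ?T0// addr_ge0// ltW.
  by rewrite mulrC; apply: ler_wpM2r; [exact: T0|rewrite lerDr].
pose C0 n := operator_kernel_coef a b c n.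
have CT n : modulus (C0 n) <= T n by exact: modulus_operator_kernel_coef.
have C0_0 : C0 0%N = 1.
  by rewrite /C0 /operator_kernel_coef muln0 !pochhammer0 fact0 !divr1 mulr1.
have C0pb : pow_bounded 1 C0.
  apply: (@bounded_pow_bounded _ (1 + (lambda / (2 * (1 - beta))) / lambda)) => -[|n].
    rewrite C0_0 modulus1 lerDl divr_ge0 ?(ltW l0)// divr_ge0 ?(ltW l0)//.
    by rewrite mulr_ge0 ?(ltW beta1').
  by apply: le_trans (CT _) _; apply: le_trans (Tb n) _; rewrite lerDr.
pose g (z : C) := z * hypergeometric
       [:: a; b / 4; (b + 1) / 4; (b + 2) / 4; (b + 3) / 4]
       [:: ofR c / 4; (ofR c + 1) / 4; (ofR c + 2) / 4; (ofR c + 3) / 4] z.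
pose G0 n : C := if n is m.+1 then C0 m else 0.
have gE : expands_as G0 g.
  apply: (@eq_expands _ (fun z => z * psum C0 z)).
    by move=> z _; rewrite /g operator_kernel_coefE.
  exact/expandsMz/pow_bounded_expands.
pose w n := G0 n * u n.
(* An equality on all of [CC R]: both sides are [limn] of the same series, also where it
   diverges. *)
have opE : operatorI a b (ofR c) f = psum w.
  by apply/funext => z; rewrite /operatorI /hadamard (coeffsE gE) (coeffsE uf).
have w0 : w 0%N = 0 by rewrite /w mul0r.
have w1 : w 1%N = 1 by rewrite /w /= C0_0 u1 mulr1.
have wT n : n.+2%:R * modulus (w n.+2) <= 2 * (1 - beta) * T n.+1.
  rewrite /w /= modulusM mulrCA mulrC.
  apply: ler_pM; rewrite ?mulr_ge0 ?CT//.
  exact: (classR_coef beta1 uf u1 fR).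
have wpb : pow_bounded 1 w.
  apply: (@bounded_pow_bounded _ (1 + 2 * (1 - beta) * ((lambda / (2 * (1 - beta))) / lambda))).
  have h0 : 0 <= 2 * (1 - beta) * ((lambda / (2 * (1 - beta))) / lambda).
    by rewrite mulr_ge0 ?divr_ge0 ?mulr_ge0 ?(ltW l0) ?(ltW beta1').
  move=> [|[|n]]; rewrite ?w0 ?w1 ?modulus0 ?modulus1 ?addr_ge0 ?lerDl//.
  apply: (@le_trans _ _ (2 * (1 - beta) * T n.+1)).
    by apply: le_trans (wT n); rewrite ler_peMl// ler1n.
  apply: (@le_trans _ _ (2 * (1 - beta) * ((lambda / (2 * (1 - beta))) / lambda))).
    by apply: ler_wpM2l; rewrite ?mulr_ge0 ?(ltW beta1').
  by rewrite lerDr.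
have wE : expands_as w (psum w) by exact: pow_bounded_expands.
rewrite opE; split; first by exists w; split; [exact: w0|exact: w1|exact: wE].
apply: (starlike_coef l0 (expands_z_derive1 wE)).
- by rewrite mul0r.
- by rewrite w1 mulr1.
- move=> N; have := hT N; rewrite ler_pdivlMr ?mulr_gt0//; apply: le_trans.
  rewrite mulr_suml; apply: ler_sum => n _; rewrite modulusM modulus_nat -[leRHS]mulrA.
  apply: ler_wpM2l; first by rewrite addr_ge0// ltW.
  by apply: le_trans (wT n) _; rewrite mulrC.
Qed.

End Analytic.

Unset Implicit Arguments.
Set Strict Implicit.

Theorem theorem3p23 (R : realType) (a b : CC R) (c lambda beta : R) :
  a != 0 -> b != 0 -> 0 < c -> modulus a + modulus b + 1 < c ->
  0 < lambda -> lambda <= 1 -> 0 <= beta -> beta < 1 ->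
  let A := modulus a in
  let B := modulus b in
  let u := fun n : nat =>
    binomN (A + 1) n
    * (Gamma (B + 4 + 2 * n%:R) / Gamma (c - A + 3 + 2 * n%:R))
    * hyp2F1_at_N1 (A + 1) (B + 4 + 2 * n%:R) (c - A + 3 + 2 * n%:R) in
  let v := fun n : nat =>
    binomN A n
    * (Gamma (B + 2 * n%:R) / Gamma (c - A + 2 * n%:R))
    * hyp2F1_at_N1 A (B + 2 * n%:R) (c - A + 2 * n%:R) in
  cvgn (series u) -> cvgn (series v) ->
  Gamma c * Gamma (c - A - B) / (Gamma B * Gamma (c - B))
  * (A / (c - A - B - 1) * limn (series u) + lambda * limn (series v))
    <= lambda * (1 + 1 / (2 * (1 - beta))) ->
  forall f : CC R -> CC R,
    classR beta f -> convexC lambda (operatorI a b (ofR c) f).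
Proof.
move=> a0 b0 c0 ABc l0 l1 beta0 beta1 A B u v cu cv h f fR.
have A0 : 0 < modulus a by rewrite modulus_gt0.
have B0 : 0 < modulus b by rewrite modulus_gt0.
apply: (convexC_operatorI a0 b0 c0 l0 beta1 _ fR) => M.
have uE n : u n = binomN (A + 1) n *
    (Gamma (B + 4 + 2 * n%:R) / Gamma (c - A + 3 + 2 * n%:R)) *
    hyp2F1_at_N1 (A + 1) (B + 4 + 2 * n%:R) (c - A + 3 + 2 * n%:R) by [].
have vE n : v n = binomN A n * (Gamma (B + 2 * n%:R) / Gamma (c - A + 2 * n%:R)) *
    hyp2F1_at_N1 A (B + 2 * n%:R) (c - A + 2 * n%:R) by [].
exact: (@kernel_coef_sum_le R A B c lambda beta A0 B0 ABc l0 u v uE vE cu cv M h).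
Qed.
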